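(* Let $(\mathcal Z,\mathcal Y)$ be a bivariate subordinator, $q\ge0$, $e(q)$ an independent exponential random variable with parameter $q$, and let $(Z,Y)$ be $(\mathcal Z,\mathcal Y)$ killed at time $e(q)$, with Laplace exponent $\kappa_{Z,Y}$. Fix real numbers $\mu,\rho,\lambda,\nu,\theta$ such that $\kappa_{Z,Y}(\theta,\mu+\lambda)$ and $\kappa_{Z,Y}(\theta,\rho)$ are finite and $\kappa_{Z,Y}(\nu,\mu)>0$. (i) If $\lambda\ne\rho-\mu$ then $$\int_{u\ge0}e^{-\mu u}E\left(e^{-\rho(\mathcal Y_{T^{\mathcal Y}_u}-u)-\lambda(u-\mathcal Y_{T^{\mathcal Y}_u-})-\nu\mathcal Z_{T^{\mathcal Y}_u-}-\theta\Delta\mathcal Z_{T^{\mathcal Y}_u}};\ T^{\mathcal Y}_u<e(q)\right)\mathrm du=\frac{\kappa_{Z,Y}(\theta,\mu+\lambda)-\kappa_{Z,Y}(\theta,\rho)}{(\mu+\lambda-\rho)\,\kappa_{Z,Y}(\nu,\mu)}.$$ (ii) If $\lambda=\rho-\mu$ then $$\int_{u\ge0}E\left(e^{-\rho\Delta\mathcal Y_{T^{\mathcal Y}_u}-\mu\mathcal Y_{T^{\mathcal Y}_u-}-\nu\mathcal Z_{T^{\mathcal Y}_u-}-\theta\Delta\mathcal Z_{T^{\mathcal Y}_u}};\ T^{\mathcal Y}_u<e(q)\right)\mathrm du=\frac{1}{\kappa_{Z,Y}(\nu,\mu)}\,\frac{\partial_+\kappa_{Z,Y}(\theta,\rho)}{\partial_+\rho},$$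 provided the right derivative $\partial_+\kappa_{Z,Y}(\theta,\rho)/\partial_+\rho$ (in $\rho$) exists.
   Context: $(\mathcal Z,\mathcal Y)$ is a (non-killed) two-dimensional subordinator started at $(0,0)$; $e(0)=\infty$. $T^{\mathcal Y}_u=\inf\{s\ge0:\mathcal Y_s>u\}$ for $u\ge0$ (with $\inf\emptyset=\infty$); $\mathcal Y_{s-}$ denotes a left limit and $\Delta\mathcal Y_s=\mathcal Y_s-\mathcal Y_{s-}$, similarly for $\mathcal Z$. The Laplace exponent is $\kappa_{Z,Y}(a,b)=q-\log E e^{-a\mathcal Z_1-b\mathcal Y_1}$, i.e. $$\kappa_{Z,Y}(a,b)=q+\mathrm d_Za+\mathrm d_Yb+\int_{t\ge0}\int_{x\ge0}(1-e^{-at-bx})\,\Pi_{Z,Y}(\mathrm dt,\mathrm dx),$$ for those $a,b\in\mathbb R$ for which it is finite, where $\mathrm d_Z,\mathrm d_Y\ge0$ are the drifts and $\Pi_{Z,Y}$ the Lévy measure of $(\mathcal Z,\mathcal Y)$. *)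

(* Defs.v *)
From HB Require Import structures.
From mathcomp Require Import all_boot all_order all_algebra.
From mathcomp Require Import all_classical all_reals all_analysis.
From mathcomp Require Import measurable_realfun.

Set Implicit Arguments.
Unset Strict Implicit.
Unset Printing Implicit Defensive.

Import Order.TTheory GRing.Theory Num.Theory.
Import numFieldNormedType.Exports.

Local Open Scope classical_set_scope.
Local Open Scope ring_scope.

(* Processes and paths are indexed by R, but only nonnegative times matter:
   every condition below constrains times 0 <= t only. *)

Definition cadlag (R : realType) (x : R -> R) : Prop :=
  (forall t, 0 <= t -> x s @[s --> t^'+] --> x t) /\
  (forall t, 0 < t -> cvg (x s @[s --> t^'-])).

(* The left limit x_{t-}, with the usual convention x_{0-} = x_0. *)
Definition left_lim (R : realType) (x : R -> R) (t : R) : R :=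
  if 0 < t then lim (x s @[s --> t^'-]) else x 0.

Definition jump (R : realType) (x : R -> R) (t : R) : R := x t - left_lim x t.

(* inf {s >= 0 : y_s > u}, equal to +oo when the set is empty. *)
Definition first_passage (R : realType) (y : R -> R) (u : R) : \bar R :=
  ereal_inf [set s%:E | s in [set s | 0 <= s /\ u < y s]].

Definition independent_systems (d : measure_display) (T : measurableType d)
    (R : realType) (P : probability T R) (F G : set (set T)) : Prop :=
  forall A B, F A -> G B -> P (A `&` B) = (P A * P B)%E.

Section processes.
Context (d : measure_display) (T : measurableType d) (R : realType).
Variable P : probability T R.
Implicit Types (Z Y : R -> {RV P >-> R}) (e : T -> \bar R) (w : T).

Definition path_of (X : R -> {RV P >-> R}) w : R -> R := fun t => X t w.

(* The sigma-algebra generated by (Z_t, Y_t), t in I. *)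
Definition sigma_process Z Y (I : set R) : set (set T) :=
  <<s \bigcup_(t in I)
        preimage_set_system setT (fun w => (Z t w, Y t w)) measurable >>.

Definition sigma_increment Z Y (s t : R) : set (set T) :=
  preimage_set_system setT
    (fun w => (Z t w - Z s w, Y t w - Y s w)) measurable.

Record bivariate_subordinator Z Y : Prop := BivariateSubordinator {
  subordinator_start : forall w, Z 0 w = 0 /\ Y 0 w = 0 ;
  subordinator_nondecreasing : forall w s t, 0 <= s -> s <= t ->
    Z s w <= Z t w /\ Y s w <= Y t w ;
  subordinator_cadlag : forall w, cadlag (path_of Z w) /\ cadlag (path_of Y w) ;
  subordinator_independent_increments : forall s t, 0 <= s -> s <= t ->
    independent_systems P
      (sigma_process Z Y `[0, s]) (sigma_increment Z Y s t) ;
  subordinator_stationary_increments : forall s h, 0 <= s -> 0 <= h ->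
    forall B : set (R * R), measurable B ->
    P [set w | B (Z (s + h) w - Z s w, Y (s + h) w - Y s w)] =
    P [set w | B (Z h w, Y h w)] }.

(* e(q): exponential with parameter q if q > 0, and e(0) = +oo. *)
Definition exponential_time (q : R) e : Prop :=
  if q == 0 then forall w, e w = +oo%E
  else exists X : {RV P >-> R},
    (forall w, e w = (X w)%:E) /\
    (forall A, measurable A -> distribution P X A = exponential_prob q A).

Definition independent_of_process e Z Y : Prop :=
  independent_systems P (preimage_set_system setT e measurable)
    (sigma_process Z Y `[0, +oo[).

(* The Laplace exponent q - log E(exp(-a Z_1 - b Y_1)) of (Z, Y) killed at an
   independent time e(q), where (Z, Y) itself is not killed. For negative a or b
   the expectation may be +oo, in which case the exponent is -oo; it is
   never +oo, the expectation being positive. *)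
Definition kappa (q : R) Z Y (a b : R) : \bar R :=
  (q%:E - lne 'E_P[(fun w => expR (- a * Z 1 w - b * Y 1 w))%R])%E.

(* E(X ; A) *)
Definition expectation_on (X : T -> R) (A : set T) : \bar R :=
  (\int[P]_(w in A) (X w)%:E)%E.

End processes.

Definition right_quotient (R : realType) (f : R -> R) (x h : R) : R :=
  (f (x + h) - f x) / h.

Definition right_derivable (R : realType) (f : R -> R) (x : R) : Prop :=
  cvg (right_quotient f x h @[h --> 0^'+]).

Definition right_derivative (R : realType) (f : R -> R) (x : R) : R :=
  lim (right_quotient f x h @[h --> 0^'+]).

(* Main.v *)
(* Sample the subordinator at the times k/(n+1). For the resulting random walk
   the integral over the level u splits over the grid interval in which u is
   passed; on each interval the u-integral is elementary, the pre-passage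
   position, the increment and the killing time are independent, and all
   Laplace transforms are powers of those at time 1. Summing a geometric series
   gives, with h = 1/(n+1) and a = mu + lambda,
     (e^(- h k(theta,rho)) - e^(- h k(theta,a))) / ((a - rho) (1 - e^(- h k(nu,mu)))),
   which tends to the right-hand side of (i) as h -> 0.
   Outside a null set of pairs (level, path) the sampled integrand converges to
   the true one, so Fatou's lemma gives one inequality. Since the parameters may
   be negative there is no dominating function; instead, shifting (mu, rho, nu,
   theta) by a common delta > 0 multiplies the integrand G by
   e^(- delta (Y_T + Z_T)), so max(0, 2 G_delta - G) <= G is bounded with bounded
   support in u, and dominated convergence yields 2 J_delta - J <= integral of G,
   J_delta being the closed formula for the shifted parameters. Letting
   delta -> 0 gives (i).
   Part (ii) follows from (i) by monotone convergence, as lambda decreases to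
   rho - mu. *)

Require Import Defs.
From HB Require Import structures.
From mathcomp Require Import all_boot all_order all_algebra.
From mathcomp Require Import all_classical all_reals all_analysis.
From mathcomp Require Import measurable_realfun ring lra.

Set Implicit Arguments.
Unset Strict Implicit.
Unset Printing Implicit Defensive.

Import Order.TTheory GRing.Theory Num.Theory.
Import numFieldNormedType.Exports.

Local Open Scope classical_set_scope.
Local Open Scope ring_scope.

(** * Integration *)

Section integration.
Local Open Scope ereal_scope.
Context d (T : measurableType d) (R : realType).

Import HBNNSimple.

(* Neither function has to be measurable: a simple function below [f] can be
   set to zero on [N], without changing its integral. *)
Lemma ge0_integral_eq_off_null (mu : {measure set T -> \bar R}) (N : set T)
    (f g : T -> \bar R) :
  measurable N -> mu N = 0 -> (forall x, 0 <= f x) -> (forall x, 0 <= g x) ->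
  (forall x, ~ N x -> f x = g x) -> \int[mu]_x f x = \int[mu]_x g x.
Proof.
move=> mN N0.
suff le_int (f1 f2 : T -> \bar R) : (forall x, 0 <= f1 x) ->
    (forall x, 0 <= f2 x) -> (forall x, ~ N x -> f1 x = f2 x) ->
    \int[mu]_x f1 x <= \int[mu]_x f2 x.
  by move=> f0 g0 fg; apply/eqP; rewrite eq_le !le_int// => x /fg.
move=> f10 f20 f12; rewrite ge0_integralTE//.
apply: ge_ereal_sup => _ [h hf <-]; rewrite -integralT_nnsfun.
have mNC : measurable (~` N) by exact: measurableC.
have mh : measurable_fun setT (fun x => (h x)%:E).
  by apply/measurable_EFinP; exact: measurable_funTS.
rewrite (@ge0_negligible_integral _ _ _ mu setT N)//; first last.
  by move=> x _; rewrite lee_fin; exact: fun_ge0.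
rewrite setTD integral_nnsfun// (mrestrict _ mNC) ge0_integralTE//.
apply: ereal_sup_ubound; exists (proj_nnsfun h mNC) => //= x.
rewrite mindicE; have [|] := boolP (x \in ~` N).
  by rewrite inE => /f12 <-; rewrite mulr1.
by rewrite mulr0.
Qed.

(** Independence on rectangles identifies the joint law with the product of the marginals, by
    uniqueness of the product measure; Tonelli then splits the integral. *)
Lemma expectation_mul_indep (P : probability T R) (X Y : T -> R) :
  measurable_fun setT X -> measurable_fun setT Y ->
  (forall w, 0 <= X w)%R -> (forall w, 0 <= Y w)%R ->
  (forall A B, measurable A -> measurable B ->
    P (X @^-1` A `&` Y @^-1` B) = P (X @^-1` A) * P (Y @^-1` B)) ->
  \int[P]_w (X w * Y w)%:E = \int[P]_w (X w)%:E * \int[P]_w (Y w)%:E.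
Proof.
move=> mX mY X0 Y0 XY.
have mXY : measurable_fun setT (fun w => (X w, Y w)).
  exact: measurable_fun_pair.
pose X' : {RV P >-> R} := HB.pack X (isMeasurableFun.Build _ _ _ _ X mX).
pose Y' : {RV P >-> R} := HB.pack Y (isMeasurableFun.Build _ _ _ _ Y mY).
pose XY' : {RV P >-> _} :=
  HB.pack (fun w => (X w, Y w)) (isMeasurableFun.Build _ _ _ _ _ mXY).
(* The absolute values make the integrand nonnegative on the whole plane, as Tonelli requires; they
   disappear on the range of [(X, Y)]. *)
pose f (p : R * R) := (`|p.1| * `|p.2|)%:E.
have mf : measurable_fun setT f.
  apply/measurable_EFinP; apply: measurable_funM;
    exact: measurableT_comp.
have f0 p : 0 <= f p by rewrite lee_fin mulr_ge0.
transitivity (\int[distribution P XY']_p f p).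
  rewrite ge0_integral_distribution//.
  by apply: eq_integral => w _; rewrite /f/= !ger0_norm.
transitivity (\int[(distribution P X' \x distribution P Y')]_p f p).
  apply/esym/eq_measure_integral => A mA _.
  exact: (product_measure_unique
    (m1 := distribution P X') (m2 := distribution P Y')).
rewrite fubini_tonelli1// /fubini_F.
have mabs : measurable_fun [set: R] (fun x : R => `|x|%:E).
  by apply/measurable_EFinP; exact: normr_measurable.
under eq_integral => x _.
  rewrite /f/=; under eq_integral do rewrite EFinM.
  rewrite ge0_integralZl//.
  over.
rewrite ge0_integralZr//; last by apply: integral_ge0.
rewrite !ge0_integral_distribution//=.
by congr (_ * _); apply: eq_integral => w _; rewrite /= ger0_norm.
Qed.

End integration.

(** * Paths observed on a grid *)

Definition grid (R : realType) (n k : nat) : R := k%:R / n.+1%:R.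

(** Continuity is taken along sequences because the grid supplies sequences of path values at the
    two ends of the passage interval. *)
Definition seq_continuous4 (R : realType) (F : R -> R -> R -> R -> R) :=
  forall (a b c d : nat -> R) (a0 b0 c0 d0 : R),
    a @ \oo --> a0 -> b @ \oo --> b0 -> c @ \oo --> c0 -> d @ \oo --> d0 ->
    F (a n) (b n) (c n) (d n) @[n --> \oo] --> F a0 b0 c0 d0.

(* The functional of the path [(z, y)] at its first passage above [u], observed
   only at the times [k / (n + 1)]; the passage occurs in the unique grid
   interval with [y (grid n k) <= u < y (grid n k.+1)]. *)
Definition grid_term (R : realType) (F : R -> R -> R -> R -> R -> R) (n k : nat)
    (z y : R -> R) (e : \bar R) (u : R) : R :=
  if (y (grid R n k) <= u) && (u < y (grid R n k.+1)) &&
     ((grid R n k.+1)%:E < e)%E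
  then F u (y (grid R n k)) (y (grid R n k.+1))
           (z (grid R n k)) (z (grid R n k.+1))
  else 0.

Definition grid_passage (R : realType) F n (z y : R -> R) (e : \bar R) (u : R) :
    \bar R :=
  (\sum_(0 <= k <oo) (grid_term F n k z y e u)%:E)%E.

(** A level that is never passed also gives 0: its passage time is [+oo], so the strict test fails
    and the default value of [fine] is never seen. *)
Definition passage (R : realType) (F : R -> R -> R -> R -> R -> R)
    (z y : R -> R) (e : \bar R) (u : R) : R :=
  let t := fine (first_passage y u) in
  if (first_passage y u < e)%E
  then F u (left_lim y t) (y t) (left_lim z t) (z t) else 0.

Section paths.
Context (R : realType).
Implicit Types (x y z : R -> R) (t u : R).

Lemma grid_ge0 n k : 0 <= grid R n k.
Proof. by rewrite divr_ge0. Qed.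

Lemma grid_le n k l : (k <= l)%N -> grid R n k <= grid R n l.
Proof. by move=> kl; rewrite ler_pM2r ?invr_gt0// ler_nat. Qed.

Lemma gridS n k : grid R n k.+1 = grid R n k + n.+1%:R^-1.
Proof. by rewrite /grid -natr1 mulrDl mul1r. Qed.

Lemma cvg_inv_succn : (n.+1%:R^-1 : R) @[n --> \oo] --> (0 : R).
Proof. exact: cvg_harmonic. Qed.

(** The sequence may take the value [t], which the filter [t^'+] ignores; at such indices the
    difference is simply zero. *)
Lemma cvg_right_continuous x t (a : nat -> R) :
  x s @[s --> t^'+] --> x t -> (forall n, t <= a n) -> a @ \oo --> t ->
  x (a n) @[n --> \oo] --> x t.
Proof.
move=> xt ta at_; apply/cvgrPdist_lt => eps eps0.
move/cvgrPdist_lt : xt => /(_ _ eps0); rewrite near_withinE => /at_.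
rewrite /= => H; near=> n; have := ta n; rewrite le_eqVlt => /predU1P[<-|].
  by rewrite subrr normr0.
by near: n.
Unshelve. all: by end_near. Qed.

Lemma cvg_left_lim x t (a : nat -> R) : cadlag x -> 0 < t ->
  (forall n, a n < t) -> a @ \oo --> t -> x (a n) @[n --> \oo] --> left_lim x t.
Proof.
move=> [_ xl] t0 at_ a_t; rewrite /left_lim t0.
by have /cvg_at_leftP := xl t t0; apply.
Qed.

Lemma right_continuous_ge x t u :
  x s @[s --> t^'+] --> x t -> (forall s, t < s -> u < x s) -> u <= x t.
Proof.
move=> xt ux.
have := @cvg_right_continuous x t (fun n => t + n.+1%:R^-1) xt.
have tn : t + n.+1%:R^-1 @[n --> \oo] --> t.
  by rewrite -[X in _ --> X]addr0; apply: cvgD cvg_inv_succn; exact: cvg_cst.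
move=> /(_ _ tn) xn; rewrite -(cvg_lim _ (xn _))//; last first.
  by move=> n; rewrite lerDl.
apply: limr_ge; first by apply/cvg_ex; eexists; apply: xn => n; rewrite lerDl.
by apply: nearW => n; rewrite ltW// ux// ltrDl.
Qed.

(** By monotonicity no other grid interval straddles [u], so the series has at most one nonzero
    term. *)
Lemma grid_termE (F : R -> R -> R -> R -> R -> R) n k z y e u :
  (forall s t, 0 <= s -> s <= t -> y s <= y t) ->
  y (grid R n k) <= u -> u < y (grid R n k.+1) ->
  grid_passage F n z y e u = (grid_term F n k z y e u)%:E.
Proof.
move=> ynd yk uk; rewrite /grid_passage.
apply/cvg_lim => //; apply: cvg_near_cst.
exists k.+1 => // m /= km; apply/eqP.
rewrite big_mkord (bigD1 (Ordinal km))//= big1 ?adde0// => i /eqP ik.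
rewrite /grid_term; case: ifPn => // /andP[/andP[yi ui] _].
case: (ltngtP i k) => [lt_ik|lt_ki|eq_ik].
- have := ynd _ _ (grid_ge0 _ _) (@grid_le n i.+1 k lt_ik).
  by move=> /(lt_le_trans ui)/lt_le_trans/(_ yk); rewrite ltxx.
- have := ynd _ _ (grid_ge0 _ _) (@grid_le n k.+1 i lt_ki).
  by move=> /(lt_le_trans uk)/lt_le_trans/(_ yi); rewrite ltxx.
- by exfalso; apply: ik; apply: val_inj.
Qed.

(** The passage time [t] is trapped in the grid interval where [u] is passed. The left end stays
    strictly below [t] and yields left limits; the right end is at least [t] and yields values by
    right continuity. *)
Lemma cvg_grid_passage (F : R -> R -> R -> R -> R -> R) z y e u :
  cadlag z -> cadlag y -> (forall s t, 0 <= s -> s <= t -> y s <= y t) ->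
  y 0 = 0 -> 0 <= u -> (forall n k, y (grid R n k) <> u) ->
  seq_continuous4 (F u) ->
  grid_passage F n z y e u @[n --> \oo] --> (passage F z y e u)%:E.
Proof.
move=> zc yc ynd y0 u0 yu Fc.
have [[s [s0 us]]|nex] := pselect (exists s, 0 <= s /\ u < y s); last first.
  have fpy : first_passage y u = +oo%E.
    rewrite /first_passage (_ : [set s | 0 <= s /\ u < y s] = set0).
      by rewrite image_set0 ereal_inf0.
    by rewrite -subset0 => s /= ?; apply: nex; exists s.
  rewrite /passage fpy ltNge leey /=.
  apply: cvg_near_cst; apply: nearW => n; apply/eqP.
  rewrite /grid_passage eseries0// => k _ _; rewrite /grid_term.
  case: ifPn => // /andP[/andP[_ uk] _].
  by exfalso; apply: nex; exists (grid R n k.+1); split => //; exact: grid_ge0.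
(* The least grid index at which the path exceeds [u] is a successor, since [y 0 = 0 <= u]; its
   predecessor is the required [k]. *)
have /choice[k kP] : forall n, exists k,
    y (grid R n k) <= u /\ u < y (grid R n k.+1).
  move=> n; have ex : exists k, u < y (grid R n k).
    exists (Num.bound (s * n.+1%:R)); apply: (lt_le_trans us); apply: ynd => //.
    by rewrite /grid ler_pdivlMr// ltW// archi_boundP// mulr_ge0.
  case: (ex_minnP ex) => -[|k] uk kmin.
    by move: uk; rewrite /grid mul0r y0 ltNge u0.
  exists k; split => //; rewrite leNgt; apply/negP => /kmin.
  by rewrite ltnn.
pose t := fine (first_passage y u).
have fp_lb : lbound [set r%:E | r in [set r | 0 <= r /\ u < y r]] (0%:E : \bar R).
  by move=> _ [r [r0 _] <-]; rewrite lee_fin.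
have fpE : first_passage y u = t%:E.
  rewrite /t fineK// ge0_fin_numE; last exact: le_ereal_inf_tmp.
  apply: (@le_lt_trans _ _ s%:E); last exact: ltry.
  by apply: ereal_inf_lbound; exists s.
have t_le r : 0 <= r -> u < y r -> t <= r.
  by move=> r0 ur; rewrite -lee_fin -fpE; apply: ereal_inf_lbound; exists r.
have t_ge r : t < r -> u < y r.
  rewrite -lte_fin -fpE => /ereal_inf_lt[_ [r' [r'0 ur'] <-]].
  by rewrite lte_fin => /ltW r'r; exact: lt_le_trans (ynd _ _ r'0 r'r).
have t0 : 0 <= t by rewrite -lee_fin -fpE; exact: le_ereal_inf_tmp.
have uyt : u <= y t by exact: right_continuous_ge (yc.1 t t0) t_ge.
(* Equality would give [u <= y t = y (grid R n (k n)) <= u], which the assumption on the level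
   excludes. *)
have kt n : grid R n (k n) < t.
  rewrite lt_neqAle; apply/andP; split.
    apply/eqP => gt; apply: (yu n (k n)); apply/eqP.
    by rewrite eq_le (kP n).1 gt uyt.
  by rewrite leNgt; apply/negP => /t_ge; rewrite ltNge (kP n).1.
have tk n : t <= grid R n (k n).+1.
  by apply: t_le; [exact: grid_ge0|exact: (kP n).2].
have t_gt0 : 0 < t by exact: le_lt_trans (grid_ge0 _ _) (kt 0%N).
have cvgl : grid R n (k n) @[n --> \oo] --> t.
  apply: (@squeeze_cvgr _ _ _ _ (fun n => t - n.+1%:R^-1) (cst t)) => //.
  - apply: nearW => n; rewrite (ltW (kt n)) andbT lerBlDr -gridS; exact: tk.
  - by rewrite -[X in _ --> X]subr0; apply: cvgB cvg_inv_succn; exact: cvg_cst.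
  - exact: cvg_cst.
have cvgr : grid R n (k n).+1 @[n --> \oo] --> t.
  apply: (@squeeze_cvgr _ _ _ _ (cst t) (fun n => t + n.+1%:R^-1)) => //.
  - by apply: nearW => n; rewrite tk gridS lerD2r (ltW (kt n)).
  - exact: cvg_cst.
  - by rewrite -[X in _ --> X]addr0; apply: cvgD cvg_inv_succn; exact: cvg_cst.
have FE n : grid_passage F n z y e u = (grid_term F n (k n) z y e u)%:E.
  by apply: grid_termE => //; [exact: (kP n).1|exact: (kP n).2].
rewrite (eq_cvg _ _ FE); apply: cvg_EFin; first exact: nearW.
rewrite /comp/= /grid_term /passage fpE/=.
under [X in X @ _ --> _]eq_fun => n do rewrite (kP n).1 (kP n).2/=.
(* If [e <= t], the right end is also at least [e] and every sampled term vanishes; if [t < e], the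
   right end is eventually below [e]. *)
case: ifPn => te; last first.
  apply: cvg_near_cst; apply: nearW => n; apply/eqP.
  rewrite ifF//; apply/negbTE; move: te; rewrite -!leNgt => /le_trans; apply.
  by rewrite lee_fin.
have e_near : \forall n \near \oo, ((grid R n (k n).+1)%:E < e)%E.
  move: te; case: (e) => [r|_|//]; last by apply: nearW => n; exact: ltry.
  by rewrite lte_fin => tr; exact: cvgr_lt cvgr _ tr.
apply: (@cvg_trans _ (F u (y (grid R n (k n))) (y (grid R n (k n).+1))
    (z (grid R n (k n))) (z (grid R n (k n).+1)) @[n --> \oo])).
  by apply: near_eq_cvg; near=> n; rewrite ifT//; near: n.
by apply: Fc; [exact: cvg_left_lim|exact: cvg_right_continuous (yc.1 t t0) tk cvgr
  |exact: cvg_left_lim|exact: cvg_right_continuous (zc.1 t t0) tk cvgr].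
Unshelve. all: by end_near. Qed.

End paths.

(** * Increments and killing *)

Section processes.
Local Open Scope ereal_scope.
Context d (T : measurableType d) (R : realType) (P : probability T R).
Variables (Z Y : R -> {RV P >-> R}).

(** A strictly positive function with zero integral would make the whole space null, contradicting
    total mass one. *)
Lemma integral_expR_gt0 (X : T -> R) : measurable_fun setT X ->
  0 < \int[P]_w (expR (X w))%:E.
Proof.
move=> mX; have mE : measurable_fun setT (fun w => (expR (X w))%:E).
  by apply/measurable_EFinP; exact: measurableT_comp.
rewrite lt0e integral_ge0 ?andbT; last by move=> w _; rewrite lee_fin expR_ge0.
apply/eqP => E0; have : \int[P]_w `|(expR (X w))%:E| = 0.
  by under eq_integral do rewrite gee0_abs ?lee_fin ?expR_ge0//.
move=> /(ae_eq_integral_abs P measurableT mE)[N [mN N0 /= sN]].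
have : P setT <= P N.
  apply: le_measure; rewrite ?inE//.
  move=> w _; apply: sN => /= /(_ Logic.I)[] /eqP.
  by rewrite gt_eqF// expR_gt0.
by rewrite probability_setT N0 lee_fin ler10.
Qed.

Lemma measurable_pair_process (s : R) :
  measurable_fun setT (fun w => (Z s w, Y s w)).
Proof. exact: measurable_fun_pair. Qed.

Lemma measurable_pair_increment (s t : R) :
  measurable_fun setT (fun w => (Z t w - Z s w, Y t w - Y s w)%R).
Proof. by apply: measurable_fun_pair; exact: measurable_funB. Qed.

(** Independence of the killing time is stated on the sigma-algebra of the process; the lemma puts
    there any measurable function of the positions at two times. *)
Lemma sigma_process_functional (s t : R) (F : (R * R) * (R * R) -> R) A :
  (0 <= s)%R -> (0 <= t)%R -> measurable_fun setT F -> measurable A ->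
  sigma_process Z Y `[0%R, +oo[
    ((fun w => F ((Z s w, Y s w), (Z t w, Y t w))) @^-1` A).
Proof.
move=> s0 t0 mF mA; set G := \bigcup_(t in `[0%R, +oo[)
  preimage_set_system setT (fun w => (Z t w, Y t w)) measurable.
have mp r : (0 <= r)%R ->
    measurable_fun setT (fun w : g_sigma_algebraType G => (Z r w, Y r w)).
  move=> r0 _ B mB; apply: sub_sigma_algebra; exists r.
    by rewrite /= in_itv/= r0.
  by exists B.
have := measurableT_comp mF (measurable_fun_pair (mp s s0) (mp t t0)).
by move=> /(_ measurableT A mA); rewrite setTI.
Qed.

Hypothesis ZY : bivariate_subordinator Z Y.

(** Stationarity says that two image measures agree, so integrals against them agree too. *)
Lemma increment_law (s h : R) (g : R * R -> R) :
  (0 <= s)%R -> (0 <= h)%R -> measurable_fun setT g -> (forall p, 0 <= g p)%R ->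
  \int[P]_w (g (Z (s + h)%R w - Z s w, Y (s + h)%R w - Y s w)%R)%:E =
  \int[P]_w (g (Z h w, Y h w))%:E.
Proof.
move=> s0 h0 mg g0.
pose I1 : {RV P >-> _} := HB.pack
  (fun w => (Z (s + h)%R w - Z s w, Y (s + h)%R w - Y s w)%R)
  (isMeasurableFun.Build _ _ _ _ _ (measurable_pair_increment s (s + h))).
pose I2 : {RV P >-> _} := HB.pack (fun w => (Z h w, Y h w))
  (isMeasurableFun.Build _ _ _ _ _ (measurable_pair_process h)).
have mE : measurable_fun setT (fun p => (g p)%:E) by exact/measurable_EFinP.
have gE0 p : 0 <= (g p)%:E by rewrite lee_fin.
transitivity (\int[distribution P I1]_p (g p)%:E).
  by rewrite ge0_integral_distribution.
transitivity (\int[distribution P I2]_p (g p)%:E); last first.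
  by rewrite ge0_integral_distribution.
apply: eq_measure_integral => A mA _.
exact: (subordinator_stationary_increments ZY).
Qed.

Lemma expectation_step (s h : R) (f g : R * R -> R) :
  (0 <= s)%R -> (0 <= h)%R -> measurable_fun setT f -> measurable_fun setT g ->
  (forall p, 0 <= f p)%R -> (forall p, 0 <= g p)%R ->
  \int[P]_w (f (Z s w, Y s w) *
    g (Z (s + h)%R w - Z s w, Y (s + h)%R w - Y s w))%:E =
  \int[P]_w (f (Z s w, Y s w))%:E * \int[P]_w (g (Z h w, Y h w))%:E.
Proof.
move=> s0 h0 mf mg f0 g0; rewrite -(increment_law s0 h0 mg g0).
apply: expectation_mul_indep => //.
- exact: measurableT_comp (measurable_pair_process s).
- exact: measurableT_comp (measurable_pair_increment s (s + h)).
move=> A B mA mB.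
have ssh : (s <= s + h)%R by rewrite lerDl.
apply: (subordinator_independent_increments ZY s0 ssh).
- apply: sub_sigma_algebra; exists s; first by rewrite /= in_itv/= s0 lexx.
  exists (f @^-1` A); last by rewrite setTI.
  by rewrite -[_ @^-1` _]setTI; exact: mf.
- exists (g @^-1` B); last by rewrite setTI.
  by rewrite -[_ @^-1` _]setTI; exact: mg.
Qed.

Variables (q : R) (e : T -> \bar R).
Hypothesis e_exponential : exponential_time P q e.
Hypothesis e_independent : independent_of_process e Z Y.

Lemma measurable_exponential_time : measurable_fun setT e.
Proof.
move: e_exponential; rewrite /exponential_time; case: ifPn => _.
  by move=> eE; rewrite (_ : e = cst +oo)//; apply/funext.
by move=> [X [eE _]]; rewrite (_ : e = EFin \o X);
  [exact/measurable_EFinP|apply/funext].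
Qed.

(** For [q = 0] both sides are 1. Otherwise the complement is split at 0, because [X] itself may
    take negative values. *)
Lemma exponential_survival (c : R) : (0 < c)%R ->
  P [set w | c%:E < e w] = (expR (- q * c))%:E.
Proof.
move=> c0; move: e_exponential; rewrite /exponential_time.
have [->|q0] := eqVneq q 0%R.
  move=> eE; rewrite oppr0 mul0r expR0 -(probability_setT P); congr (P _).
  by apply/seteqP; split => // w _ /=; rewrite eE ltry.
move=> [X [eE Xq]].
have Xneg : distribution P X `]-oo, (0%R : R)[ = 0.
  rewrite Xq//; apply: integral0_eq => x; rewrite /= in_itv/= => x0.
  by rewrite lt0_exponential_pdf.
have Xc : distribution P X `[(0%R : R), c] = (1 - expR (- q * c))%:E.
  by rewrite Xq// exponential_prob_itv0c.
have Xle : distribution P X `]-oo, c] = (1 - expR (- q * c))%:E.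
  rewrite (@itv_bndbnd_setU _ _ -oo%O (BLeft 0%R))//; last by rewrite bnd_simp ltW.
  rewrite measureU//.
    rewrite -Xc -[RHS]add0e; congr (_ + _); exact: Xneg.
  rewrite -subset0 => x/= []; rewrite !in_itv/= => x0 /andP[x0' _].
  by move: x0; rewrite ltNge x0'.
rewrite (_ : [set w | _] = ~` (X @^-1` `]-oo, c])); last first.
  by apply/seteqP; split => w /=; rewrite in_itv/= eE lte_fin ltNge => /negP.
rewrite probability_setC; last first.
  by rewrite -[_ @^-1` _]setTI; exact: measurable_funP.
transitivity (1 - distribution P X `]-oo, c]) => //.
by rewrite Xle -EFinB opprB addrCA subrr addr0.
Qed.

(** The killing time is independent of the whole process, hence of the position at [s] and the
    increment jointly; survival beyond [s + h] contributes the last factor. *)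
Lemma expectation_step_killed (s h : R) (f g : R * R -> R) :
  (0 <= s)%R -> (0 < h)%R -> measurable_fun setT f -> measurable_fun setT g ->
  (forall p, 0 <= f p)%R -> (forall p, 0 <= g p)%R ->
  \int[P]_w (f (Z s w, Y s w) *
    g (Z (s + h)%R w - Z s w, Y (s + h)%R w - Y s w) *
    \1_[set x : \bar R | ((s + h)%:E < x)%E] (e w))%:E =
  \int[P]_w (f (Z s w, Y s w))%:E * \int[P]_w (g (Z h w, Y h w))%:E *
    (expR (- q * (s + h)))%:E.
Proof.
move=> s0 h0 mf mg f0 g0; rewrite -expectation_step//; last exact: ltW.
have sh0 : (0 < s + h)%R by rewrite ltr_wpDl.
have mC : measurable [set x : \bar R | (s + h)%:E < x].
  rewrite (_ : [set _ | _] = `](s + h)%:E, +oo]%classic).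
    exact: emeasurable_itv.
  by apply/seteqP; split => x /=; rewrite in_itv/= ?leey ?andbT.
have mp : measurable_fun setT (fun w => f (Z s w, Y s w) *
    g (Z (s + h)%R w - Z s w, Y (s + h)%R w - Y s w))%R.
  apply: measurable_funM; first exact: measurableT_comp (measurable_pair_process s).
  exact: measurableT_comp (measurable_pair_increment s (s + h)).
have m1 : measurable_fun setT
    (fun w => \1_[set x : \bar R | ((s + h)%:E < x)%E] (e w) : R).
  by apply: measurableT_comp measurable_exponential_time; exact: measurable_indic.
rewrite expectation_mul_indep//.
- congr (_ * _); rewrite -exponential_survival//.
  have mS : measurable [set w | (s + h)%:E < e w].
    rewrite (_ : [set w | _] = setT `&` e @^-1` [set x | (s + h)%:E < x]).
      exact: measurable_exponential_time.
    by rewrite setTI.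
  by rewrite -[in RHS](setIT [set w | _]) -integral_indic.
- by move=> w; rewrite mulr_ge0.
move=> A B mA mB; rewrite setIC muleC.
apply: e_independent.
  exists (\1_[set x : \bar R | ((s + h)%:E < x)%E] @^-1` B); last by rewrite setTI.
  rewrite -[X in measurable X]setTI.
  by have := @measurable_indic _ _ R setT _ mC; apply.
(* [F] recovers the increment from the two positions, so the product is a functional of the process
   at times [s] and [s + h]. *)
pose F (p : (R * R) * (R * R)) :=
  (f p.1 * g (p.2.1 - p.1.1, p.2.2 - p.1.2))%R.
apply: (@sigma_process_functional s (s + h) F) => //; first exact: ltW.
apply: measurable_funM; first exact: measurableT_comp.
apply: measurableT_comp => //.
by apply: measurable_fun_pair => /=; apply: measurable_funB;
  do 2 apply: measurableT_comp => //.
Qed.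

End processes.

(** * Laplace transforms *)

Section real_analysis.
Context (R : realType).

Lemma integral_expR_itvco (al y y' : R) : al != 0 -> y <= y' ->
  (\int[lebesgue_measure]_(u in `[y, y'[) (expR (- al * u))%:E =
   ((expR (- al * y) - expR (- al * y')) / al)%:E)%E.
Proof.
move=> al0; rewrite le_eqVlt => /predU1P[<-|yy'].
  by rewrite set_itvco0 integral_set0 subrr mul0r.
have cE : continuous (fun u : R => expR (- al * u)).
  move=> u; apply: continuous_comp; last exact: continuous_expR.
  by apply: cvgM; [exact: cvg_cst|exact: cvg_id].
have cF : continuous (fun u : R => - al^-1 * expR (- al * u)).
  by move=> u; apply: cvgM; [exact: cvg_cst|exact: cE].
have dF (u : R) : is_derive u 1 (fun u : R => - al^-1 * expR (- al * u))
    (expR (- al * u)).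
  by apply: is_derive_eq; rewrite /GRing.scale/=; field.
rewrite integral_itv_bndo_bndc; last first.
  apply/measurable_EFinP; apply: measurable_funTS.
  exact: continuous_measurable_fun.
rewrite (@continuous_FTC2 _ _ (fun u => - al^-1 * expR (- al * u)))//.
- by rewrite -EFinB; congr (_%:E); field.
- exact: continuous_subspaceT.
- split=> [u _||]; first by have [] := dF u.
  + by apply: cvg_at_right_filter; exact: cF.
  + by apply: cvg_at_left_filter; exact: cF.
- by move=> u _; rewrite derive1E; have [_ ->] := dF u.
Qed.

(** With [h = 1/(n+1)], the inequality [1 + t <= exp t] at [t = h x] and [t = - h x] squeezes the
    expression between [x / (1 + h x)] and [x], whatever the sign of [x]. *)
Lemma cvg_onem_expR (x : R) :
  (1 - expR (- (n.+1%:R^-1 * x))) * n.+1%:R @[n --> \oo] --> x.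
Proof.
have hx : n.+1%:R^-1 * x @[n --> \oo] --> (0 : R).
  by rewrite -[X in _ --> X](mul0r x); apply: cvgM (cvg_cst _); exact: cvg_inv_succn.
have hx1 : 1 + n.+1%:R^-1 * x @[n --> \oo] --> (1 : R).
  by rewrite -[X in _ --> X]addr0; apply: cvgD hx; exact: cvg_cst.
have near1 : \forall n \near \oo, 0 < 1 + n.+1%:R^-1 * x.
  exact: (cvgr_gt _ hx1).
apply: (@squeeze_cvgr _ _ _ _ (fun n => x / (1 + n.+1%:R^-1 * x)) (cst x)).
- near=> n.
  have : 0 < 1 + n.+1%:R^-1 * x by near: n; exact: near1.
  set h : R := n.+1%:R^-1 => h0.
  have n0 : 0 < n.+1%:R :> R by [].
  have hK : h * n.+1%:R = 1 by rewrite mulVf// gt_eqF.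
  apply/andP; split.
    have : expR (- (h * x)) <= (1 + h * x)^-1.
      by rewrite expRN lef_pV2 ?posrE ?expR_gt0// expR_ge1Dx.
    rewrite -lerN2 -(lerD2l 1) -(ler_pM2r n0); apply: le_trans.
    rewrite le_eqVlt; apply/orP; left; apply/eqP.
    have -> : 1 - (1 + h * x)^-1 = (h * x) / (1 + h * x).
      by field; rewrite gt_eqF.
    by rewrite mulrAC [h * x * _]mulrAC hK mul1r.
  have := expR_ge1Dx (- (h * x)); rewrite -lerN2 -(lerD2l 1) -(ler_pM2r n0).
  by move=> /le_trans; apply; rewrite opprD addrA subrr add0r opprK mulrAC hK mul1r.
- rewrite -[X in _ --> X]divr1; apply: cvgM; first exact: cvg_cst.
  by apply: cvgV => //; exact: oner_neq0.
- exact: cvg_cst.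
Unshelve. all: by end_near. Qed.

End real_analysis.

Section laplace.
Local Open Scope ereal_scope.
Context d (T : measurableType d) (R : realType) (P : probability T R).
Variables (Z Y : R -> {RV P >-> R}) (q : R).
Hypothesis ZY : bivariate_subordinator Z Y.

Lemma measurable_exponent (s a b : R) :
  measurable_fun setT (fun w => - a * Z s w - b * Y s w)%R.
Proof. by apply: measurable_funB; exact: measurable_funM. Qed.

Lemma laplace1E (a b : R) : -oo < kappa q Z Y a b ->
  \int[P]_w (expR (- a * Z 1%R w - b * Y 1%R w))%:E =
  (expR (q - fine (kappa q Z Y a b)))%:E.
Proof.
have := integral_expR_gt0 P (measurable_exponent 1%R a b).
rewrite /kappa unlock; case: (\int[P]_w _) => [r r0 _|//|//].
by rewrite lne_EFin//= opprB addrC subrK lnK.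
Qed.

Lemma kappa_neq_pinfty (a b : R) : kappa q Z Y a b < +oo.
Proof.
have := integral_expR_gt0 P (measurable_exponent 1%R a b).
rewrite /kappa unlock; case: (\int[P]_w _) => [r r0|//|//].
by rewrite lne_EFin// ltry.
Qed.

Lemma laplaceD (s h a b : R) : (0 <= s)%R -> (0 <= h)%R ->
  \int[P]_w (expR (- a * Z (s + h)%R w - b * Y (s + h)%R w))%:E =
  \int[P]_w (expR (- a * Z s w - b * Y s w))%:E *
  \int[P]_w (expR (- a * Z h w - b * Y h w))%:E.
Proof.
move=> s0 h0; pose f (p : R * R) := expR (- a * p.1 - b * p.2).
have mf : measurable_fun setT f.
  apply: measurableT_comp => //; apply: measurable_funB; exact: measurable_funM.
rewrite -(expectation_step ZY (f := f) (g := f))//; first last.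
- by move=> p; exact: expR_ge0.
- by move=> p; exact: expR_ge0.
apply: eq_integral => w _; congr (_%:E); rewrite /f/= -expRD; congr expR.
by ring.
Qed.

(** Let [x] be the transform at time [1/(n+1)]. The transform at [k/(n+1)] is [x ^+ k], and
    [x ^+ n.+1] is the known transform at time 1, so [x] is its positive root. *)
Lemma laplace_grid n k (a b : R) : -oo < kappa q Z Y a b ->
  \int[P]_w (expR (- a * Z (grid R n k) w - b * Y (grid R n k) w))%:E =
  (expR (grid R n k * (q - fine (kappa q Z Y a b))))%:E.
Proof.
move=> kab; set h : R := grid R n 1.
pose x := \int[P]_w (expR (- a * Z h w - b * Y h w))%:E.
have powE m : \int[P]_w (expR (- a * Z (grid R n m) w - b * Y (grid R n m) w))%:E
    = x ^+ m.
  elim: m => [|m IH].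
    rewrite (eq_integral (cst 1)) => [|w _]; last first.
      rewrite /grid mul0r; have [-> ->] := subordinator_start ZY w.
      by rewrite !mulr0 subrr expR0.
    by rewrite integral_cst// mul1e; exact: probability_setT.
  rewrite gridS -div1r laplaceD ?grid_ge0 ?divr_ge0// IH expeS muleC.
  by congr (_ * _).
have x0 : 0 < x by apply: integral_expR_gt0; exact: measurable_exponent.
have := powE n.+1; rewrite {1 2}/grid divff ?pnatr_eq0// laplace1E//.
(* An infinite [x] would have an infinite power [n.+1], but the transform at time 1 is finite. *)
rewrite powE; case: x x0 {powE} => [r| |]//; last by rewrite expeS gt0_mulye ?expe_gt0.
rewrite lte_fin => r0; rewrite -!EFin_expe => -[rE]; congr (_%:E).
rewrite -(lnK r0) -!expRM_natl; congr expR.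
have -> : (q - fine (kappa q Z Y a b) = n.+1%:R * ln r)%R.
  by apply: expR_inj; rewrite rE expRM_natl lnK.
by rewrite /grid mulrA divfK ?pnatr_eq0.
Qed.

Lemma subordinator_ge0 (s : R) w : (0 <= s)%R -> (0 <= Z s w /\ 0 <= Y s w)%R.
Proof.
move=> s0; have [Z0 Y0] := subordinator_start ZY w.
by have := subordinator_nondecreasing ZY w (lexx 0%R) s0; rewrite Z0 Y0.
Qed.

(** [Z] and [Y] are nonnegative at time 1, so the expectation decreases in the parameters. Lower
    bounds on the exponent thus survive upward shifts. *)
Lemma le_kappa (a a' b b' : R) : (a <= a')%R -> (b <= b')%R ->
  kappa q Z Y a b <= kappa q Z Y a' b'.
Proof.
move=> aa' bb'; rewrite /kappa leeB// unlock.
have mE (c c' : R) : measurable_fun setT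
    (fun w => (expR (- c * Z 1%R w - c' * Y 1%R w))%:E).
  by apply/measurable_EFinP; apply: measurableT_comp => //; exact: measurable_exponent.
rewrite lee_lne; last 2 first.
- by rewrite in_itv/= leey andbT integral_ge0.
- by rewrite in_itv/= leey andbT integral_ge0.
apply: ge0_le_integral => // w _.
rewrite lee_fin ler_expR; have [Z0 Y0] := subordinator_ge0 w (@ler01 R).
move: (Z 1%R w) (Y 1%R w) Z0 Y0 => z y z0 y0.
by have := ler_wpM2r z0 aa'; have := ler_wpM2r y0 bb'; lra.
Qed.

(** Dominated convergence, the unshifted exponential being an integrable bound. *)
Lemma cvg_kappa_shift (a b : R) : -oo < kappa q Z Y a b ->
  fine (kappa q Z Y (a + m.+1%:R^-1) (b + m.+1%:R^-1))%R @[m --> \oo] -->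
  fine (kappa q Z Y a b).
Proof.
move=> kab; pose E (a b : R) := \int[P]_w (expR (- a * Z 1%R w - b * Y 1%R w))%:E.
have mE (a' b' : R) : measurable_fun setT
    (fun w => (expR (- a' * Z 1%R w - b' * Y 1%R w))%:E).
  by apply/measurable_EFinP; apply: measurableT_comp => //; exact: measurable_exponent.
have hm0 m : (0 <= m.+1%:R^-1 :> R)%R by rewrite invr_ge0.
have kabm m : -oo < kappa q Z Y (a + m.+1%:R^-1)%R (b + m.+1%:R^-1)%R.
  by apply: lt_le_trans kab _; apply: le_kappa; rewrite lerDl.
have Ecvg : E (a + m.+1%:R^-1)%R (b + m.+1%:R^-1)%R @[m --> \oo] --> E a b.
  apply: (@dominated_cvg _ _ _ P setT measurableT _ _
    (fun w => (expR (- a * Z 1%R w - b * Y 1%R w))%:E)) => //.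
  - move=> w _; apply: cvg_EFin; first exact: nearW.
    apply: continuous_cvg; first exact: continuous_expR.
    have hD (c : R) : (c + m.+1%:R^-1)%R @[m --> \oo] --> c.
      rewrite -[X in _ --> X]addr0.
      by apply: (@cvgD R R^o); [exact: cvg_cst|exact: cvg_inv_succn].
    apply: cvgB; apply: cvgM; try exact: cvg_cst; last exact: hD.
    by apply: cvgN; exact: hD.
  - apply/integrableP; split => //.
    under eq_integral do rewrite gee0_abs ?lee_fin ?expR_ge0//.
    by rewrite laplace1E// ltry.
  - move=> m w _; rewrite gee0_abs ?lee_fin ?expR_ge0// ler_expR.
    have [Z0 Y0] := subordinator_ge0 w (@ler01 R).
    move: (Z 1%R w) (Y 1%R w) Z0 Y0 (m.+1%:R^-1)%R (hm0 m) => z y z0 y0 h h0.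
    by have := mulr_ge0 h0 z0; have := mulr_ge0 h0 y0; lra.
have fineK' (a' b' : R) : -oo < kappa q Z Y a' b' ->
    fine (kappa q Z Y a' b') = (q - ln (fine (E a' b')))%R.
  by move=> k; rewrite /E laplace1E//= expRK opprB addrC subrK.
rewrite fineK' => [|//]; under eq_fun do rewrite fineK'//.
apply: cvgB; first exact: cvg_cst.
apply: continuous_cvg; last first.
  by apply: fine_cvg; rewrite fineK// /E laplace1E.
by apply: continuous_ln; rewrite /E laplace1E//= expR_gt0.
Qed.
End laplace.

(** * The integral for the sampled path *)

(** The integrand of (i) including [exp (- mu u)], with [y], [z] the values before passage and [y'],
    [z'] those at passage. For [lam = rho - mu] the level cancels and the integrand of (ii)
    remains. *)
Definition weight (R : realType) (mu rho lam nu theta u y y' z z' : R) : R :=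
  expR (- mu * u - rho * (y' - u) - lam * (u - y) - nu * z - theta * (z' - z)).

Definition measurable_weight (R : realType) (F : R -> R -> R -> R -> R -> R) :=
  measurable_fun [set: R * ((R * R) * (R * R))]
    (fun p => F p.1 p.2.1.1 p.2.1.2 p.2.2.1 p.2.2.2).

Lemma measurable_weight_expR (R : realType) (mu rho lam nu theta : R) :
  measurable_weight (weight mu rho lam nu theta).
Proof.
apply: measurableT_comp => //.
have m1 : measurable_fun setT (fun p : R * ((R * R) * (R * R)) => p.1).
  exact: measurable_fst.
have m2 : measurable_fun setT (fun p : R * ((R * R) * (R * R)) => p.2.1.1).
  exact: (measurableT_comp measurable_fst
    (measurableT_comp measurable_fst measurable_snd)).
have m3 : measurable_fun setT (fun p : R * ((R * R) * (R * R)) => p.2.1.2).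
  exact: (measurableT_comp measurable_snd
    (measurableT_comp measurable_fst measurable_snd)).
have m4 : measurable_fun setT (fun p : R * ((R * R) * (R * R)) => p.2.2.1).
  exact: (measurableT_comp measurable_fst
    (measurableT_comp measurable_snd measurable_snd)).
have m5 : measurable_fun setT (fun p : R * ((R * R) * (R * R)) => p.2.2.2).
  exact: (measurableT_comp measurable_snd
    (measurableT_comp measurable_snd measurable_snd)).
have cst (x : R) : measurable_fun setT
  (fun _ : R * ((R * R) * (R * R)) => x) := measurable_cst x.
exact: (measurable_funB (measurable_funB (measurable_funB (measurable_funB
  (measurable_funM (cst (- mu)) m1) (measurable_funM (cst rho)
  (measurable_funB m3 m1))) (measurable_funM (cst lam) (measurable_funB m1 m2)))
  (measurable_funM (cst nu) m4)) (measurable_funM (cst theta)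
  (measurable_funB m5 m4))).
Qed.

Lemma seq_continuous4_weight (R : realType) (mu rho lam nu theta u : R) :
  seq_continuous4 (weight mu rho lam nu theta u).
Proof.
move=> a b c d a0 b0 c0 d0 ha hb hc hd.
apply: continuous_cvg; first exact: continuous_expR.
apply: cvgB; last by apply: cvgM; [exact: cvg_cst|exact: cvgB].
apply: cvgB; last by apply: cvgM; [exact: cvg_cst|exact: hc].
apply: cvgB; last first.
  by apply: cvgM; [exact: cvg_cst|apply: cvgB; [exact: cvg_cst|exact: ha]].
apply: cvgB; first exact: cvg_cst.
by apply: cvgM; [exact: cvg_cst|apply: cvgB; [exact: hb|exact: cvg_cst]].
Qed.

Section grid_integral.
Local Open Scope ereal_scope.
Context d (T : measurableType d) (R : realType) (P : probability T R).
Variables (Z Y : R -> {RV P >-> R}) (q : R) (e : T -> \bar R).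
Hypothesis ZY : bivariate_subordinator Z Y.
Hypothesis e_exponential : exponential_time P q e.
Hypothesis e_independent : independent_of_process e Z Y.

Lemma measurable_grid_term F n k : measurable_weight F ->
  measurable_fun [set: R * T] (fun p =>
    grid_term F n k (path_of Z p.2) (path_of Y p.2) (e p.2) p.1).
Proof.
move=> mF.
have mX (X : R -> {RV P >-> R}) t :
    measurable_fun [set: R * T] (fun p => path_of X p.2 t).
  exact: (measurableT_comp (measurable_funP (X t)) measurable_snd).
apply: measurable_fun_ifT.
- apply: measurable_and; first apply: measurable_and.
  + by apply: measurable_fun_ler.
  + by apply: measurable_fun_ltr.
  + apply: measurable_fun_lte => //.
    exact: (measurableT_comp (measurable_exponential_time e_exponential)
      measurable_snd).
- have := measurableT_comp mF (measurable_fun_pair measurable_fst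
    (measurable_fun_pair
      (measurable_fun_pair (mX Y (grid R n k)) (mX Y (grid R n k.+1)))
      (measurable_fun_pair (mX Z (grid R n k)) (mX Z (grid R n k.+1))))).
  exact.
- exact: measurable_cst.
Qed.

Lemma grid_term_ge0 F n k (z y : R -> R) (x : \bar R) (u : R) :
  (forall u a b c f, 0 <= F u a b c f)%R -> (0 <= grid_term F n k z y x u)%R.
Proof. by move=> F0; rewrite /grid_term; case: ifP. Qed.

Variables (mu rho lam nu theta : R).
Hypothesis rho_neq : (mu + lam != rho)%R.
Let al := (mu + lam - rho)%R.

(* The positive part changes nothing at increments of [(Z, Y)] and makes [g]
   nonnegative everywhere. *)
Let g (p : R * R) : R :=
  (expR (- theta * p.1) *
   Num.max 0 ((expR (- rho * p.2) - expR (- (mu + lam) * p.2)) / al))%R.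

Let f (p : R * R) : R := expR (- nu * p.1 - mu * p.2).

Let al0 : (al != 0)%R. Proof. by rewrite subr_eq0. Qed.

(** The order of the two exponentials follows the sign of [al], so the quotient is nonnegative for
    either sign. *)
Lemma expR_quotient_ge0 (y : R) : (0 <= y)%R ->
  (0 <= (expR (- rho * y) - expR (- (mu + lam) * y)) / al)%R.
Proof.
move=> y0; have [al_gt0|al_lt0|alE] := ltgtP 0%R al.
- rewrite divr_ge0 ?(ltW al_gt0)// subr_ge0 ler_expR.
  by move: al_gt0; rewrite /al; nra.
- rewrite mulr_le0 ?invr_le0 ?(ltW al_lt0)// subr_le0 ler_expR.
  by move: al_lt0; rewrite /al; nra.
- by move: al0; rewrite -alE eqxx.
Qed.

(** For a fixed path the level runs over [[y, y'[]. The elementary integral regroups into a function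
    of the position before passage, one of the increment, and the survival indicator. *)
Lemma integral_grid_term_path n k w :
  \int[lebesgue_measure]_u (grid_term (weight mu rho lam nu theta) n k
     (path_of Z w) (path_of Y w) (e w) u)%:E =
  (f (Z (grid R n k) w, Y (grid R n k) w) *
   g (Z (grid R n k.+1) w - Z (grid R n k) w,
      Y (grid R n k.+1) w - Y (grid R n k) w) *
   \1_[set x : \bar R | ((grid R n k.+1)%:E < x)%E] (e w))%:E.
Proof.
rewrite indicE; set b := (e w \in _).
have bE : b = ((grid R n k.+1)%:E < e w) by apply/idP/idP; rewrite /b inE.
set y := Y (grid R n k) w; set y' := Y (grid R n k.+1) w.
set z := Z (grid R n k) w; set z' := Z (grid R n k.+1) w.
have yy' : (y <= y')%R.
  by apply: (subordinator_nondecreasing ZY w (grid_ge0 _ _ _) (grid_le _ _ _)).2.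
have [be|nbe] := boolP b; last first.
  rewrite mulr0; apply: integral0_eq => u _.
  by rewrite /grid_term -bE (negbTE nbe) andbF.
(* [c] is the part of the exponent free of [u]; the rest is [- al * u]. *)
rewrite mulr1; set c : R :=
  (- rho * y' + lam * y - nu * z - theta * (z' - z))%R.
transitivity (\int[lebesgue_measure]_(u in `[y, y'[)
    ((expR c)%:E * (expR (- al * u))%:E)).
  rewrite [RHS]integral_mkcond; apply: eq_integral => u _.
  rewrite patchE /grid_term -bE be andbT mem_setE in_itv/=.
  rewrite -/y -/y' -/z -/z' /path_of.
  case: ifP => // _; rewrite -EFinM -expRD; congr (expR _)%:E.
  by rewrite -/y -/y' -/z -/z' /c /al; ring.
have mE : measurable_fun `[y, y'[ (fun u : R => (expR (- al * u))%:E).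
  by apply/measurable_EFinP/measurable_funTS/measurableT_comp.
rewrite ge0_integralZl//.
rewrite integral_expR_itvco// -EFinM; congr (_%:E).
rewrite /f /g /= max_r; last by apply: expR_quotient_ge0; rewrite subr_ge0.
rewrite mulrA [in LHS]mulrA -!expRD; rewrite mulrA; congr (_ / al)%R.
rewrite !mulrBr -!expRD; congr (expR _ - expR _)%R; rewrite /c /al; ring.
Qed.

Hypotheses (kappa1 : -oo < kappa q Z Y theta (mu + lam))
  (kappa2 : -oo < kappa q Z Y theta rho) (kappa0 : 0 < kappa q Z Y nu mu).
Let k1 := fine (kappa q Z Y theta (mu + lam)).
Let k2 := fine (kappa q Z Y theta rho).
Let k0 := fine (kappa q Z Y nu mu).

Let mg : measurable_fun setT g.
Proof.
have mexp (c : R) : measurable_fun setT (fun p : R * R => expR (c * p.2)).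
  by apply: measurableT_comp => //; exact: measurable_funM.
apply: measurable_funM.
  by apply: measurableT_comp => //; exact: measurable_funM.
apply: measurable_maxr => //; apply: measurable_funM => //.
exact: measurable_funB.
Qed.

Let mf : measurable_fun setT f.
Proof.
by apply: measurableT_comp => //; apply: measurable_funB; exact: measurable_funM.
Qed.

Let g_ge0 p : (0 <= g p)%R.
Proof. by rewrite mulr_ge0 ?expR_ge0// le_max lexx. Qed.

Lemma integral_step_weight n :
  \int[P]_w (g (Z (grid R n 1) w, Y (grid R n 1) w))%:E =
  ((expR (grid R n 1 * (q - k2)) - expR (grid R n 1 * (q - k1))) / al)%:E.
Proof.
pose E b w := expR (- theta * Z (grid R n 1) w - b * Y (grid R n 1) w).
have EE b : -oo < kappa q Z Y theta b -> \int[P]_w (E b w)%:E =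
    (expR (grid R n 1 * (q - fine (kappa q Z Y theta b))))%:E.
  exact: laplace_grid.
(* Both transforms are finite, which allows the expectation of the difference to be split. *)
have iE b : -oo < kappa q Z Y theta b -> P.-integrable setT (EFin \o E b).
  move=> kb; apply/integrableP; split.
    apply/measurable_EFinP; apply: measurableT_comp => //.
    exact: measurable_exponent.
  under eq_integral do rewrite gee0_abs ?lee_fin ?expR_ge0//.
  by rewrite EE// ltry.
transitivity (\int[P]_w (al^-1%:E * ((E rho w)%:E - (E (mu + lam)%R w)%:E))).
  apply: eq_integral => w _; rewrite -EFinB -EFinM; congr (_%:E).
  have [_ Y0] := subordinator_ge0 ZY w (grid_ge0 R n 1).
  rewrite /g /= max_r; last exact: expR_quotient_ge0.
  by rewrite /E !expRD -!mulNr; ring.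
rewrite integralZl//; last exact: integrableB (iE _ kappa2) (iE _ kappa1).
by rewrite integralB_EFin ?iE// !EE// -EFinB -EFinM mulrC.
Qed.

Lemma integral_grid_term n k :
  \int[(@lebesgue_measure R \x P)%E]_p (grid_term (weight mu rho lam nu theta)
    n k (path_of Z p.2) (path_of Y p.2) (e p.2) p.1)%:E =
  (expR (grid R n k * (q - k0)) *
   ((expR (grid R n 1 * (q - k2)) - expR (grid R n 1 * (q - k1))) / al) *
   expR (- q * grid R n k.+1))%:E.
Proof.
rewrite fubini_tonelli2; last 2 first.
- apply/measurable_EFinP; apply: measurable_grid_term.
  exact: measurable_weight_expR.
- by move=> p; rewrite lee_fin grid_term_ge0// => *; exact: expR_ge0.
rewrite /fubini_G; under eq_integral do rewrite integral_grid_term_path.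
have -> : grid R n k.+1 = (grid R n k + grid R n 1)%R by rewrite gridS -div1r.
rewrite (expectation_step_killed ZY e_exponential e_independent)//; last 3 first.
- exact: grid_ge0.
- by rewrite divr_gt0.
- by move=> p; exact: expR_ge0.
have k0_gtNy : -oo < kappa q Z Y nu mu by exact: lt_trans (ltNyr 0%R) kappa0.
by rewrite integral_step_weight (laplace_grid ZY n k k0_gtNy) !EFinM.
Qed.

(** Summation over [k] gives a geometric series, whose ratio [exp (- k0/(n+1))] is below 1 because
    [k0 > 0]. *)
Lemma integral_grid_passage n :
  \int[(@lebesgue_measure R \x P)%E]_p (grid_passage (weight mu rho lam nu theta)
    n (path_of Z p.2) (path_of Y p.2) (e p.2) p.1) =
  ((expR (- (n.+1%:R^-1 * k2)) - expR (- (n.+1%:R^-1 * k1))) /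
   (al * (1 - expR (- (n.+1%:R^-1 * k0)))))%:E.
Proof.
rewrite integral_nneseries//; last 2 first.
- move=> k; apply/measurable_EFinP; apply: measurable_grid_term.
  exact: measurable_weight_expR.
- by move=> k p _; rewrite lee_fin grid_term_ge0// => *; exact: expR_ge0.
set a := ((expR (- (n.+1%:R^-1 * k2)) - expR (- (n.+1%:R^-1 * k1))) / al)%R.
set z := expR (- (n.+1%:R^-1 * k0)).
have k00 : (0 < k0)%R.
  by apply: fine_gt0; rewrite kappa0; exact: kappa_neq_pinfty.
have z1 : (`|z| < 1)%R.
  by rewrite ger0_norm ?expR_ge0// expR_lt1 oppr_lt0 mulr_gt0// invr_gt0.
transitivity (\sum_(0 <= k <oo) (geometric a z k)%:E).
  apply: eq_eseriesr => k _; rewrite integral_grid_term; congr (_%:E).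
  rewrite /= /a /z -expRM_natl /grid !mul1r.
  have -> : (k.+1%:R = k%:R + 1 :> R)%R by rewrite natr1.
  set h := (n.+1%:R^-1)%R.
  transitivity ((expR (h * (q - k2)) - expR (h * (q - k1))) *
    (expR (k%:R * h * (q - k0)) * expR (- q * ((k%:R + 1) * h))) / al)%R.
    move: (expR (h * (q - k2)) - expR (h * (q - k1)))%R
      (expR (k%:R * h * (q - k0))) (expR (- q * ((k%:R + 1) * h))) (al^-1)%R.
    by move=> D A B c; ring.
  (* The killing rate cancels: the transforms contribute [q h + q k h], survival contributes
     [- q (k + 1) h]. *)
  have expE c : (expR (h * (q - c)) * (expR (k%:R * h * (q - k0)) *
      expR (- q * ((k%:R + 1) * h))) = expR (- (h * c)) * expR (k%:R * - (h * k0)))%R.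
    by rewrite -!expRD; congr expR; ring.
  by rewrite mulrBl (expE k2) (expE k1) -mulrBl mulrAC.
have <- : (a / (1 - z) = (expR (- (n.+1%:R^-1 * k2)) - expR (- (n.+1%:R^-1 * k1))) /
   (al * (1 - z)))%R by rewrite /a invfM mulrA.
apply/cvg_lim => //.
rewrite (_ : (fun n => _) = EFin \o series (geometric a z)); last first.
  by apply/funext => m; rewrite /series/= sumEFin.
by apply: cvg_EFin; [exact: nearW|exact: cvg_geometric_series].
Qed.

End grid_integral.

(** Scaling numerator and denominator by [n + 1] turns each difference from 1 into a sequence
    converging to the corresponding exponent. *)
Lemma cvg_grid_integral (R : realType) (al k0 k1 k2 : R) : al != 0 -> k0 != 0 ->
  (expR (- (n.+1%:R^-1 * k2)) - expR (- (n.+1%:R^-1 * k1))) /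
    (al * (1 - expR (- (n.+1%:R^-1 * k0)))) @[n --> \oo] -->
  (k1 - k2) / (al * k0).
Proof.
move=> al0 k00; pose A k n : R := (1 - expR (- (n.+1%:R^-1 * k))) * n.+1%:R.
have cA k : A k @ \oo --> k by exact: cvg_onem_expR.
have cden : al * A k0 n @[n --> \oo] --> al * k0.
  by apply: cvgM; [exact: cvg_cst|exact: cA].
have alk0 : al * k0 != 0 by rewrite mulf_neq0.
have lim_eq : (A k1 n - A k2 n) / (al * A k0 n) @[n --> \oo] -->
    (k1 - k2) / (al * k0).
  by apply: cvgM; [apply: cvgB; exact: cA|exact: cvgV].
apply: (cvg_trans _ lim_eq); apply: near_eq_cvg; apply: nearW => n.
rewrite /A -mulrBl mulrA -mulf_div divff ?pnatr_eq0// mulr1.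
by congr (_ / _); ring.
Qed.

(** * The passage functional at regular levels *)

Section passage_integral.
Local Open Scope ereal_scope.
Context d (T : measurableType d) (R : realType) (P : probability T R).
Variables (Z Y : R -> {RV P >-> R}) (q : R) (e : T -> \bar R).
Hypothesis ZY : bivariate_subordinator Z Y.
Hypothesis e_exponential : exponential_time P q e.

Local Notation m := (@lebesgue_measure R \x P)%E.

(* When the first passage above [u] occurs at a grid point where [Y] equals [u],
   the value at the left end of the grid interval need not approach the left
   limit; for a fixed path this excludes only countably many levels. *)
Definition grid_levels : set (R * T) :=
  \bigcup_n \bigcup_k [set p | Y (grid R n k) p.2 = p.1].

Definition regular_levels : set (R * T) :=
  [set p | (0 <= p.1)%R] `\` grid_levels.

Lemma measurable_grid_levels : measurable grid_levels.
Proof.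
apply: bigcupT_measurable => n; apply: bigcupT_measurable => k.
rewrite (_ : [set p | _] =
    (fun p : R * T => Y (grid R n k) p.2 - p.1)%R @^-1` [set 0%R]).
  rewrite -[X in measurable X]setTI.
  have : measurable_fun setT (fun p : R * T => Y (grid R n k) p.2 - p.1)%R.
    apply: measurable_funB; last exact: measurable_fst.
    exact: (measurableT_comp (measurable_funP (Y (grid R n k))) measurable_snd).
  by apply => //.
by apply/seteqP; split => p /= [/eqP]; [rewrite -subr_eq0|rewrite subr_eq0] => /eqP.
Qed.

Lemma measurable_regular_levels : measurable regular_levels.
Proof.
apply: measurableD; last exact: measurable_grid_levels.
rewrite (_ : [set p | _] = `[0%R, +oo[ `*` setT); first exact: measurableX.
by apply/seteqP; split => p /=; rewrite in_itv/= andbT => // -[].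
Qed.

(** Tonelli with the path fixed: each section is a countable set of levels. *)
Lemma grid_levels_null : m grid_levels = 0.
Proof.
have mB := measurable_grid_levels.
transitivity (\int[m]_p (\1_grid_levels p)%:E).
  by rewrite integral_indic// setIT.
rewrite fubini_tonelli2//; last 1 first.
  exact/measurable_EFinP/measurable_indic.
apply: integral0_eq => w _; rewrite /fubini_G.
have mBw : measurable (ysection grid_levels w) by exact: measurable_ysection.
transitivity (\int[lebesgue_measure]_u (\1_(ysection grid_levels w) u)%:E).
  by apply: eq_integral => u _; rewrite !indicE mem_ysection.
rewrite integral_indic// setIT; apply: countable_lebesgue_measure0.
rewrite (_ : ysection _ w = \bigcup_n \bigcup_k [set Y (grid R n k) w]).
  by apply: bigcup_countable => // n _; apply: bigcup_countable.
apply/seteqP; split => u; rewrite /ysection/= inE => -[n _ [k _ /= YE]];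
  by exists n => //; exists k.
Qed.

(** The same null set sliced by levels: for almost every [u] the irregular paths form a null event.
    The iterated integral of the theorem calls for this order. *)
Lemma ae_section_grid_levels : exists2 N : set R,
  measurable N /\ lebesgue_measure N = 0 &
  forall u, ~ N u -> P (xsection grid_levels u) = 0.
Proof.
have mB := measurable_grid_levels.
have int0 : \int[lebesgue_measure]_u `|P (xsection grid_levels u)| = 0.
  under eq_integral do rewrite gee0_abs//.
  exact: grid_levels_null.
have mx : measurable_fun setT (fun u : R => P (xsection grid_levels u)).
  exact: measurable_fun_xsection.
have [N [mN N0 sN]] :=
  (ae_eq_integral_abs lebesgue_measure measurableT mx).1 int0.
exists N => // u Nu; apply: contrapT => Pu; apply: Nu; apply: sN => /= /(_ Logic.I).
exact: Pu.
Qed.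

Section functional.
Variable F : R -> R -> R -> R -> R -> R.
Hypothesis mF : measurable_weight F.
Hypothesis F0 : forall u a b c f, (0 <= F u a b c f)%R.

Let gp n (p : R * T) :=
  grid_passage F n (path_of Z p.2) (path_of Y p.2) (e p.2) p.1.
Let pas (p : R * T) :=
  passage F (path_of Z p.2) (path_of Y p.2) (e p.2) p.1.

Lemma measurable_grid_passage n : measurable_fun setT (gp n).
Proof.
apply: (@ge0_emeasurable_sum _ _ _ setT _ xpredT) => [k p _ _|k _].
  by rewrite lee_fin grid_term_ge0.
by apply/measurable_EFinP; exact: (measurable_grid_term Z Y e_exponential n k mF).
Qed.

Lemma grid_passage_ge0 n p : 0 <= gp n p.
Proof. by apply: nneseries_ge0 => k _ _; rewrite lee_fin grid_term_ge0. Qed.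

Lemma passage_ge0 p : (0 <= pas p)%R.
Proof. by rewrite /pas /passage; case: ifP. Qed.

Lemma integral_regular_levels n :
  \int[m]_(p in regular_levels) gp n p = \int[m]_p gp n p.
Proof.
rewrite integral_mkcond.
apply: (@ge0_integral_eq_off_null _ _ _ m grid_levels).
- exact: measurable_grid_levels.
- exact: grid_levels_null.
- by move=> p; rewrite erestrict_ge0// => *; exact: grid_passage_ge0.
- exact: grid_passage_ge0.
(* Off [grid_levels], a point outside [regular_levels] has a negative level, which lies below every
   grid value of [Y]. *)
move=> [u w] Bp; rewrite patchE; case: ifPn => // /negP; rewrite inE => Dp.
rewrite /gp /grid_passage eseries0// => k _ _.
rewrite /grid_term; case: ifPn => // /andP[/andP[Yu _] _].
exfalso; apply: Dp; split => //=; apply: le_trans Yu.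
by have [] := subordinator_ge0 ZY w (grid_ge0 R n k).
Qed.

Hypothesis Fc : forall u, seq_continuous4 (F u).

Lemma cvg_grid_passage_regular p : regular_levels p ->
  gp n p @[n --> \oo] --> (pas p)%:E.
Proof.
move=> [/= u0 Bp]; apply: cvg_grid_passage => //.
- by have [] := subordinator_cadlag ZY p.2.
- by have [] := subordinator_cadlag ZY p.2.
- by move=> s t s0 st; have [] := subordinator_nondecreasing ZY p.2 s0 st.
- by have [] := subordinator_start ZY p.2.
- by move=> n k Ye; apply: Bp; exists n => //; exists k.
Qed.

Lemma measurable_passage :
  measurable_fun regular_levels (fun p => (pas p)%:E).
Proof.
apply: (emeasurable_fun_cvg gp); last exact: cvg_grid_passage_regular.
by move=> n; apply: measurable_funTS; exact: measurable_grid_passage.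
Qed.

(** Passes from the iterated integral of the theorem to the product space. The factor [c]
    accommodates the [exp (- mu u)] that stands outside the expectation in (i). *)
Lemma iterated_integral_passage (c : R -> R) : measurable_fun setT c ->
  (forall u, 0 <= c u)%R ->
  \int[lebesgue_measure]_(u in `[0%R, +oo[) ((c u)%:E *
    expectation_on P (fun w => let z := path_of Z w in let y := path_of Y w in
      let t := fine (first_passage y u) in
      F u (left_lim y t) (y t) (left_lim z t) (z t))
      [set w | first_passage (path_of Y w) u < e w]) =
  \int[m]_(p in regular_levels) (c p.1 * pas p)%:E.
Proof.
move=> mc c0; have mD := measurable_regular_levels.
(* Extending by zero gives a function measurable on the whole space; measurability of [pas] is
   established only on regular levels. *)
pose pasD := (fun p => (pas p)%:E) \_ regular_levels.
have mpasD : measurable_fun setT pasD.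
  by apply/(measurable_restrictT _ mD); exact: measurable_passage.
have pasD0 p : 0 <= pasD p.
  by rewrite erestrict_ge0// => r _; rewrite lee_fin passage_ge0.
pose h (p : R * T) := (c p.1)%:E * pasD p.
have mh : measurable_fun setT h.
  apply: emeasurable_funM => //; apply/measurable_EFinP.
  exact: (measurableT_comp mc measurable_fst).
have h0 p : 0 <= h p by rewrite mule_ge0// lee_fin.
transitivity (\int[m]_p h p); last first.
  rewrite [RHS]integral_mkcond; apply: eq_integral => p _.
  by rewrite /h /pasD !patchE; case: ifP; rewrite ?mule0// EFinM.
rewrite fubini_tonelli1// integral_mkcond /fubini_F.
have [N [mN N0] NP] := ae_section_grid_levels.
apply: (@ge0_integral_eq_off_null _ _ _ (@lebesgue_measure R) N _ _ mN N0).
- move=> u; apply: erestrict_ge0 => v _; rewrite mule_ge0 ?lee_fin//.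
  by apply: integral_ge0 => w _; rewrite lee_fin.
- by move=> u; exact: integral_ge0.
move=> u Nu; rewrite patchE; case: ifPn => [|/negP]; rewrite inE/= in_itv/= andbT.
  move=> u0; rewrite /h/= ge0_integralZl//; last first.
  - by rewrite lee_fin.
  - exact: (measurableT_comp mpasD (pair1_measurable u)).
  congr (_ * _); rewrite /expectation_on [LHS]integral_mkcond.
  apply: (@ge0_integral_eq_off_null _ _ _ P (xsection grid_levels u)).
  - exact: measurable_xsection measurable_grid_levels.
  - exact: NP.
  - by move=> w; apply: erestrict_ge0 => w' _; rewrite lee_fin.
  - by [].
  move=> w Bw; have Dp : regular_levels (u, w).
    by split => //; rewrite /xsection/= inE in Bw.
  rewrite /pasD !patchE (mem_set Dp) /pas /passage/=.
  by case: ifPn => [/set_mem/= ->//|/negP]; rewrite inE/= => /negP/negbTE ->.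
move=> u0; apply/esym/integral0_eq => w _.
by rewrite /h /pasD patchE ifF ?mule0//; apply/negP; rewrite inE => -[].
Qed.

End functional.
End passage_integral.

(** * Convergence of the sampled integral *)

Section truncation.
Context (R : realType).
Implicit Types (u y z dl : R).

Lemma cvg_max0 (x : nat -> R) (l : R) : x @ \oo --> l ->
  Num.max 0 (x n) @[n --> \oo] --> Num.max 0 l.
Proof.
move=> xl; rewrite maxr_absE; under eq_fun do rewrite maxr_absE.
apply: cvgM; last exact: cvg_cst.
apply: cvgD; first by apply: cvgD => //; exact: cvg_cst.
by apply: cvg_norm; apply: cvgB => //; exact: cvg_cst.
Qed.

(* Shifting all the parameters but [lam] by [dl] multiplies the weight by
   [exp (- dl (y' + z'))], so the positive part below is bounded, vanishes for
   large levels, and is at least [2 (shifted weight) - weight]. *)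
Definition truncated_weight dl (mu rho lam nu theta u y y' z z' : R) : R :=
  Num.max 0 (2 * weight (mu + dl) (rho + dl) lam (nu + dl) (theta + dl) u y y' z z'
             - weight mu rho lam nu theta u y y' z z').

Variables (mu rho lam nu theta : R).

Lemma weight_ge0 u y y' z z' : 0 <= weight mu rho lam nu theta u y y' z z'.
Proof. exact: expR_ge0. Qed.

(** The shifted coefficients telescope: [u + (y' - u) + z + (z' - z) = y' + z']. *)
Lemma weight_shift dl u y y' z z' :
  weight (mu + dl) (rho + dl) lam (nu + dl) (theta + dl) u y y' z z' =
  weight mu rho lam nu theta u y y' z z' * expR (- (dl * (y' + z'))).
Proof. by rewrite /weight -expRD; congr expR; ring. Qed.

Lemma truncated_weight_ge0 dl u y y' z z' :
  0 <= truncated_weight dl mu rho lam nu theta u y y' z z'.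
Proof. by rewrite /truncated_weight le_max lexx. Qed.

Lemma truncated_weight_le dl u y y' z z' : 0 <= dl -> 0 <= y' -> 0 <= z' ->
  truncated_weight dl mu rho lam nu theta u y y' z z' <=
  weight mu rho lam nu theta u y y' z z'.
Proof.
move=> dl0 y0 z0; rewrite /truncated_weight ge_max weight_ge0/=.
rewrite weight_shift; have := weight_ge0 u y y' z z'.
have : expR (- (dl * (y' + z'))) <= 1.
  by rewrite expR_le1 oppr_le0 mulr_ge0// addr_ge0.
by move: (weight _ _ _ _ _ _ _ _ _ _) (expR _) => a b b1 a0; nra.
Qed.

(** If [y' + z' <= 1/dl], the five quantities multiplied by the parameters all lie in [[0, 1/dl]].
    Otherwise the damping factor is at most 1/2 and the positive part vanishes. *)
Lemma truncated_weight_bound dl u y y' z z' : 0 < dl ->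
  0 <= y -> y <= u -> u <= y' -> 0 <= z -> z <= z' ->
  truncated_weight dl mu rho lam nu theta u y y' z z' <=
  if u <= dl^-1 then
    expR ((`|mu| + `|rho| + `|lam| + `|nu| + `|theta|) * dl^-1) else 0.
Proof.
move=> dl0 y0 yu uy' z0 zz'.
have y'0 : 0 <= y' by rewrite (le_trans y0)// (le_trans yu).
have z'0 : 0 <= z' by rewrite (le_trans z0).
have [M|M] := leP (y' + z') dl^-1.
  rewrite ifT; last by rewrite (le_trans uy')// (le_trans _ M)// lerDl.
  apply: (le_trans (truncated_weight_le _ _ _ (ltW dl0) y'0 z'0)).
  have bnd (c x : R) : 0 <= x -> x <= dl^-1 -> - c * x <= `|c| * dl^-1.
    move=> x0 xM; apply: (@le_trans _ _ (`|c| * x)).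
      by rewrite ler_wpM2r// -normrN ler_norm.
    by rewrite ler_wpM2l.
  rewrite /weight ler_expR !mulrDl -!mulNr.
  by rewrite !lerD// bnd//; lra.
rewrite /truncated_weight weight_shift max_l.
  by case: ifP => // _; exact: expR_ge0.
have M1 : 1 < dl * (y' + z') by rewrite -ltr_pdivrMl// mulr1.
have : expR (- (dl * (y' + z'))) <= 2^-1.
  rewrite expRN lef_pV2 ?posrE ?expR_gt0//.
  by apply: le_trans (expR_ge1Dx _); lra.
have := weight_ge0 u y y' z z'.
by move: (weight _ _ _ _ _ _ _ _ _ _) (expR _) => a b a0 b1; nra.
Qed.

Lemma measurable_truncated_weight dl :
  measurable_weight (truncated_weight dl mu rho lam nu theta).
Proof.
apply: measurable_maxr; first exact: measurable_cst.
apply: measurable_funB; last exact: measurable_weight_expR.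
by apply: measurable_funM; [exact: measurable_cst|exact: measurable_weight_expR].
Qed.

Lemma seq_continuous4_truncated_weight dl u :
  seq_continuous4 (truncated_weight dl mu rho lam nu theta u).
Proof.
move=> a b c d a0 b0 c0 d0 ha hb hc hd; rewrite /truncated_weight.
have c1 := @seq_continuous4_weight R mu rho lam nu theta u _ _ _ _ _ _ _ _ ha hb hc hd.
have c2 := @seq_continuous4_weight R (mu + dl) (rho + dl) lam (nu + dl) (theta + dl)
  u _ _ _ _ _ _ _ _ ha hb hc hd.
apply: cvg_max0; apply: cvgB c1; apply: cvgM c2; exact: cvg_cst.
Qed.

End truncation.

Lemma grid_passage_le (R : realType) (F : R -> R -> R -> R -> R -> R) n
    (z y : R -> R) (e : \bar R) (u c : R) :
  (forall s t, 0 <= s -> s <= t -> y s <= y t) -> 0 <= c ->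
  (forall k, y (grid R n k) <= u -> u <= y (grid R n k.+1) ->
    F u (y (grid R n k)) (y (grid R n k.+1))
        (z (grid R n k)) (z (grid R n k.+1)) <= c) ->
  (grid_passage F n z y e u <= c%:E)%E.
Proof.
move=> ynd c0 Fc.
have [[k [yk uk]]|nk] := pselect (exists k, y (grid R n k) <= u /\
    u < y (grid R n k.+1)).
  rewrite (grid_termE F z e ynd yk uk) lee_fin /grid_term.
  by case: ifP => // _; apply: Fc => //; exact: ltW.
rewrite /grid_passage eseries0// => k _ _; rewrite /grid_term.
by case: ifPn => // /andP[/andP[yk uk] _]; exfalso; apply: nk; exists k.
Qed.

Lemma fine_first_passage_ge0 (R : realType) (y : R -> R) (u : R) :
  0 <= fine (first_passage y u).
Proof.
apply: fine_ge0; apply: le_ereal_inf_tmp => _ [s [s0 _] <-].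
by rewrite lee_fin.
Qed.

(** * Upper and lower bounds for the passage integral, and formula (i) on the product space *)

Section main.
Local Open Scope ereal_scope.
Context d (T : measurableType d) (R : realType) (P : probability T R).
Variables (Z Y : R -> {RV P >-> R}) (q : R) (e : T -> \bar R).
Hypothesis ZY : bivariate_subordinator Z Y.
Hypothesis e_exponential : exponential_time P q e.
Hypothesis e_independent : independent_of_process e Z Y.

Local Notation m := (@lebesgue_measure R \x P)%E.
Local Notation gp F n p :=
  (grid_passage F n (path_of Z p.2) (path_of Y p.2) (e p.2) p.1).
Local Notation pas F p :=
  (passage F (path_of Z p.2) (path_of Y p.2) (e p.2) p.1).
Local Notation D := (regular_levels Y).

Let mD : measurable D := measurable_regular_levels Y.

(** Dominated convergence: the sampled functional is at most the constant [C] on levels in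
    [[0, 1/dl]], a set of finite product measure, and zero at larger levels. *)
Lemma cvg_integral_truncated (dl mu rho lam nu theta : R) : (0 < dl)%R ->
  \int[m]_(p in D) gp (truncated_weight dl mu rho lam nu theta) n p @[n --> \oo]
  --> \int[m]_(p in D) (pas (truncated_weight dl mu rho lam nu theta) p)%:E.
Proof.
move=> dl0; set K := truncated_weight _ _ _ _ _ _.
have mK : measurable_weight K by exact: measurable_truncated_weight.
have K0 u a b c f : (0 <= K u a b c f)%R by exact: truncated_weight_ge0.
have Kc u : seq_continuous4 (K u) by exact: seq_continuous4_truncated_weight.
pose C := expR ((`|mu| + `|rho| + `|lam| + `|nu| + `|theta|) * dl^-1).
pose A : set (R * T) := `[(0 : R)%R, (dl^-1)%R] `*` setT.
have mA : measurable A by exact: measurableX.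
have mAfin : m A < +oo.
  have -> : m A = lebesgue_measure (`[0%R, (dl^-1)%R] : set R) * P setT.
    exact: product_measure1E.
  rewrite [X in _ * X]probability_setT mule1 lebesgue_measure_itv/=.
  by case: ifP => _; rewrite ?ltry// -EFinB ltry.
have ig : m.-integrable D (fun p => (C * \1_A p)%:E).
  apply: (@integrableS _ _ _ m setT D) => //.
  under eq_fun do rewrite EFinM.
  apply: integrableZl => //.
  apply/integrableP; split; first exact/measurable_EFinP/measurable_indic.
  under eq_integral do rewrite gee0_abs ?lee_fin//.
  by rewrite integral_indic// setIT.
apply: (@dominated_cvg _ _ _ m D mD _ _ (fun p => (C * \1_A p)%:E)) => //.
- move=> n; apply: measurable_funTS.
  exact: (measurable_grid_passage Z Y e_exponential mK K0).
- by move=> p Dp; exact: (cvg_grid_passage_regular ZY Kc Dp).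
move=> n [u w] [/= u0 _]; rewrite gee0_abs; last first.
  exact: (grid_passage_ge0 Z Y e K0 n (u, w)).
apply: grid_passage_le.
- by move=> s t s0 st; have [] := subordinator_nondecreasing ZY w s0 st.
- by rewrite mulr_ge0// expR_ge0.
move=> k yu uy.
have [z0 y0] := subordinator_ge0 ZY w (grid_ge0 R n k).
have [zz' _] := subordinator_nondecreasing ZY w (grid_ge0 R n k)
  (@grid_le R n _ _ (leqnSn k)).
apply: (le_trans (truncated_weight_bound mu rho lam nu theta dl0 y0 yu uy z0 zz')).
rewrite indicE; case: ifP => ud; last by rewrite mulr_ge0// expR_ge0.
by rewrite mem_set ?mulr1// /A; split => //=; rewrite in_itv/= u0.
Qed.

Section formula.
Variables (mu rho lam nu theta : R).
Hypothesis rho_neq : (mu + lam != rho)%R.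
Hypotheses (kappa1 : -oo < kappa q Z Y theta (mu + lam))
  (kappa2 : -oo < kappa q Z Y theta rho) (kappa0 : 0 < kappa q Z Y nu mu).

Let J (a b c : \bar R) : R :=
  ((fine a - fine b) / ((mu + lam - rho) * fine c))%R.

Let kappa0_fine : (0 < fine (kappa q Z Y nu mu))%R.
Proof. by apply: fine_gt0; rewrite kappa0; exact: kappa_neq_pinfty. Qed.

Let W := weight mu rho lam nu theta.

Let mW : measurable_weight W. Proof. exact: measurable_weight_expR. Qed.

Let W0 u a b c f : (0 <= W u a b c f)%R. Proof. exact: weight_ge0. Qed.

Let Wc u : seq_continuous4 (W u). Proof. exact: seq_continuous4_weight. Qed.

Let J0 := J (kappa q Z Y theta (mu + lam)) (kappa q Z Y theta rho)
  (kappa q Z Y nu mu).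

Let al0 : (mu + lam - rho != 0)%R. Proof. by rewrite subr_eq0. Qed.

Lemma cvg_integral_grid_passage : \int[m]_p gp W n p @[n --> \oo] --> J0%:E.
Proof.
under eq_fun do rewrite (integral_grid_passage ZY e_exponential e_independent
  rho_neq kappa1 kappa2 kappa0).
apply: cvg_EFin; first exact: nearW.
by apply: cvg_grid_integral => //; rewrite gt_eqF.
Qed.

(** Fatou's lemma; the regular levels carry the whole sampled integral, whose limit is known. *)
Lemma integral_passage_le : \int[m]_(p in D) (pas W p)%:E <= J0%:E.
Proof.
have -> : \int[m]_(p in D) (pas W p)%:E =
    \int[m]_(p in D) limn_einf (fun n => gp W n p).
  apply: eq_integral => p /set_mem Dp.
  have cp := cvg_grid_passage_regular ZY Wc Dp.
  rewrite is_cvg_limn_einfE; first by apply/esym/cvg_lim.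
  by apply/cvg_ex; eexists; exact: cp.
apply: (@le_trans _ _ (limn_einf (fun n => \int[m]_(p in D) gp W n p))).
  apply: fatou => //.
  - by move=> n; apply: measurable_funTS;
      exact: (measurable_grid_passage Z Y e_exponential mW W0).
  - by move=> n p _; exact: (grid_passage_ge0 Z Y e W0).
under eq_fun do rewrite (integral_regular_levels e ZY W0).
rewrite is_cvg_limn_einfE; last first.
  by apply/cvg_ex; eexists; exact: cvg_integral_grid_passage.
by rewrite (cvg_lim _ cvg_integral_grid_passage).
Qed.

Lemma integral_truncated_le (dl : R) : (0 < dl)%R ->
  \int[m]_(p in D) (pas (truncated_weight dl mu rho lam nu theta) p)%:E <=
  \int[m]_(p in D) (pas W p)%:E.
Proof.
move=> dl0; set K := truncated_weight _ _ _ _ _ _.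
have mK : measurable_weight K by exact: measurable_truncated_weight.
have K0 u a b c f : (0 <= K u a b c f)%R by exact: truncated_weight_ge0.
have Kc u : seq_continuous4 (K u) by exact: seq_continuous4_truncated_weight.
apply: ge0_le_integral => //.
- by move=> p _; rewrite lee_fin; exact: (passage_ge0 Z Y e K0).
- exact: (measurable_passage ZY e_exponential mK K0 Kc).
- exact: (measurable_passage ZY e_exponential mW W0 Wc).
move=> [u w] _; rewrite lee_fin /passage; case: ifP => // _.
have [z0 y0] := subordinator_ge0 ZY w (fine_first_passage_ge0 (path_of Y w) u).
exact: truncated_weight_le (ltW dl0) y0 z0.
Qed.

(** Termwise this is [2 b - a <= max 0 (2 b - a)]; the additive form avoids subtracting possibly
    infinite quantities. *)
Lemma shifted_weight_le (dl : R) n (p : R * T) :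
  2%:E * gp (weight (mu + dl) (rho + dl) lam (nu + dl) (theta + dl)) n p <=
  gp (truncated_weight dl mu rho lam nu theta) n p + gp W n p.
Proof.
have t0 F k : (forall u a b c f, 0 <= F u a b c f)%R ->
    0 <= (grid_term F n k (path_of Z p.2) (path_of Y p.2) (e p.2) p.1)%:E.
  by move=> F0; rewrite lee_fin grid_term_ge0.
have V0 u a b c f :
  (0 <= weight (mu + dl) (rho + dl) lam (nu + dl) (theta + dl) u a b c f)%R.
  exact: weight_ge0.
have K0 u a b c f : (0 <= truncated_weight dl mu rho lam nu theta u a b c f)%R.
  exact: truncated_weight_ge0.
rewrite /grid_passage -nneseriesZl; last by move=> k _; exact: t0.
rewrite -nneseriesD; last 2 first.
- by move=> k _ _; exact: t0.
- by move=> k _ _; exact: t0.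
apply: lee_nneseries => [k _ _|k _].
  by rewrite mule_ge0 ?lee_fin//; exact: t0.
rewrite -EFinM -EFinD lee_fin /grid_term; case: ifP => _.
  by rewrite -lerBlDr /truncated_weight le_max lexx orbT.
by rewrite mulr0 addr0.
Qed.

End formula.

Section lower_bound.
Variables (mu rho lam nu theta : R).
Hypothesis rho_neq : (mu + lam != rho)%R.
Hypotheses (kappa1 : -oo < kappa q Z Y theta (mu + lam))
  (kappa2 : -oo < kappa q Z Y theta rho) (kappa0 : 0 < kappa q Z Y nu mu).

Let J (dl : R) : R :=
  ((fine (kappa q Z Y (theta + dl) (mu + lam + dl)) -
    fine (kappa q Z Y (theta + dl) (rho + dl))) /
   ((mu + lam - rho) * fine (kappa q Z Y (nu + dl) (mu + dl))))%R.

Let V := \int[m]_(p in D) (pas (weight mu rho lam nu theta) p)%:E.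

(** Integrating the sampled inequality and letting the mesh tend to 0 gives [2 J dl] at most the
    truncated integral plus [J 0], and the truncated integral is at most [V]. *)
Lemma integral_passage_ge_shift (dl : R) : (0 < dl)%R ->
  (2 * J dl)%:E <= V + (J 0)%:E.
Proof.
move=> dl0; have dl_ge0 := ltW dl0.
have cW : \int[m]_p gp (weight mu rho lam nu theta) n p @[n --> \oo] --> (J 0)%:E.
  rewrite /J !addr0; exact: cvg_integral_grid_passage.
have cV : \int[m]_p gp (weight (mu + dl) (rho + dl) lam (nu + dl) (theta + dl)) n p
    @[n --> \oo] --> (J dl)%:E.
  (* Shifting [mu] and [rho] together leaves the denominator factor [mu + lam - rho] unchanged. *)
  have E1 : (mu + dl + lam = mu + lam + dl)%R by rewrite addrAC.
  have E2 : (mu + dl + lam - (rho + dl) = mu + lam - rho)%R by ring.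
  have := @cvg_integral_grid_passage (mu + dl) (rho + dl) lam (nu + dl) (theta + dl).
  rewrite E2 E1; apply.
  - by rewrite -subr_eq0 -E1 E2 subr_eq0.
  - by apply: lt_le_trans kappa1 _; apply: (le_kappa _ ZY); rewrite lerDl.
  - by apply: lt_le_trans kappa2 _; apply: (le_kappa _ ZY); rewrite lerDl.
  - by apply: lt_le_trans kappa0 _; apply: (le_kappa _ ZY); rewrite lerDl.
set K := truncated_weight dl mu rho lam nu theta.
have cK := @cvg_integral_truncated dl mu rho lam nu theta dl0.
apply: (@le_trans _ _ (\int[m]_(p in D) (pas K p)%:E + (J 0)%:E)); last first.
  by rewrite leeD2r//; exact: integral_truncated_le.
have cKW : \int[m]_(p in D) gp K n p + \int[m]_p gp (weight mu rho lam nu theta) n p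
    @[n --> \oo] --> \int[m]_(p in D) (pas K p)%:E + (J 0)%:E.
  by apply: cvgeD => //; exact: fin_num_adde_defl.
have c2V : 2%:E * \int[m]_p
    gp (weight (mu + dl) (rho + dl) lam (nu + dl) (theta + dl)) n p
    @[n --> \oo] --> (2 * J dl)%:E.
  by rewrite EFinM; apply: cvgeZl.
apply: (lee_cvg_to c2V cKW); apply: nearW => n.
have K0 u a b c f : (0 <= K u a b c f)%R by exact: truncated_weight_ge0.
have mK : measurable_weight K by exact: measurable_truncated_weight.
have mW (mu' rho' lam' nu' theta' : R) :
    measurable_fun setT (fun p : R * T => gp (weight mu' rho' lam' nu' theta') n p).
  apply: (measurable_grid_passage Z Y e_exponential).
    exact: measurable_weight_expR.
  by move=> *; exact: weight_ge0.
have W0 (mu' rho' lam' nu' theta' : R) (p : R * T) :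
    0 <= gp (weight mu' rho' lam' nu' theta') n p.
  by apply: grid_passage_ge0 => *; exact: weight_ge0.
have mKn : measurable_fun setT (fun p : R * T => gp K n p).
  exact: (measurable_grid_passage Z Y e_exponential mK K0).
have K0n (p : R * T) : 0 <= gp K n p by exact: grid_passage_ge0.
rewrite (integral_regular_levels e ZY K0) -ge0_integralD//.
rewrite -[leLHS]ge0_integralZl//.
apply: ge0_le_integral => //.
- by move=> p _; rewrite mule_ge0.
- by apply: measurable_funeM; exact: mW.
- by apply: emeasurable_funD => //; exact: mW.
- by move=> p _; exact: shifted_weight_le.
- exact: mW.
- exact: mW.
Qed.

Lemma integral_passage_weight : V = (J 0)%:E.
Proof.
have VJ : V <= (J 0)%:E by rewrite /J !addr0; exact: integral_passage_le.
have V0 : 0 <= V.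
  apply: integral_ge0 => p _; rewrite lee_fin; apply: passage_ge0.
  by move=> *; exact: weight_ge0.
have Vfin : V \is a fin_num by rewrite ge0_fin_numE// (le_lt_trans VJ)// ltry.
apply/eqP; rewrite eq_le VJ /= -(fineK Vfin) lee_fin.
(* The limit of the shifted inequality as [dl = 1/(n+1)] tends to 0; the finite [J 0] then cancels
   to give the lower bound. *)
suff : (2 * J 0 <= fine V + J 0)%R by lra.
have hn n : (0 < n.+1%:R^-1 :> R)%R by rewrite invr_gt0.
have cJ : (2 * J n.+1%:R^-1)%R @[n --> \oo] --> (2 * J 0)%R.
  apply: cvgM; first exact: cvg_cst.
  rewrite /J !addr0; apply: cvgM.
    by apply: cvgB; exact: cvg_kappa_shift.
  have k0 : (0 < fine (kappa q Z Y nu mu))%R.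
    by apply: fine_gt0; rewrite kappa0; exact: kappa_neq_pinfty.
  apply: cvgV; first by rewrite mulf_neq0 ?subr_eq0// gt_eqF.
  apply: cvgM; first exact: cvg_cst.
  by apply: cvg_kappa_shift => //; exact: lt_trans (ltNyr 0%R) kappa0.
apply: (cvgr_to_le cJ); apply: nearW => n.
by rewrite -lee_fin EFinD fineK//; exact: integral_passage_ge_shift.
Qed.

End lower_bound.
End main.

(** * The case lambda = rho - mu *)

(** Strictly before the passage time the path is at most [u], and so is its left limit. Hence
    [u - y_{t-} >= 0], which makes the weight monotone in [lam]. *)
Lemma left_lim_first_passage_le (R : realType) (y : R -> R) (u : R) :
  cadlag y -> y 0 = 0 -> 0 <= u -> (first_passage y u < +oo)%E ->
  left_lim y (fine (first_passage y u)) <= u.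
Proof.
move=> [_ yl] y0 u0 fpy; rewrite /left_lim; case: ifPn => [t0|_]; last by rewrite y0.
have fpfin : first_passage y u \is a fin_num.
  rewrite ge0_fin_numE//; apply: le_ereal_inf_tmp => _ [s [s0 _] <-].
  by rewrite lee_fin.
apply: limr_le; first exact: yl.
near=> s; rewrite leNgt; apply/negP => us.
have s0 : 0 <= s by rewrite ltW//; near: s; exact: nbhs_left_gt.
have : (first_passage y u <= s%:E)%E by apply: ereal_inf_lbound; exists s.
rewrite -(fineK fpfin) lee_fin leNgt => /negP; apply.
by near: s; exact: nbhs_left_lt.
Unshelve. all: by end_near. Qed.

Section limit_case.
Local Open Scope ereal_scope.
Context d (T : measurableType d) (R : realType) (P : probability T R).
Variables (Z Y : R -> {RV P >-> R}) (q : R) (e : T -> \bar R).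
Hypothesis ZY : bivariate_subordinator Z Y.
Hypothesis e_exponential : exponential_time P q e.
Hypothesis e_independent : independent_of_process e Z Y.
Variables (mu rho nu theta : R).
Hypotheses (kappa2 : -oo < kappa q Z Y theta rho)
  (kappa0 : 0 < kappa q Z Y nu mu).

Local Notation m := (@lebesgue_measure R \x P)%E.
Local Notation pas F p :=
  (passage F (path_of Z p.2) (path_of Y p.2) (e p.2) p.1).
Local Notation D := (regular_levels Y).

Lemma integral_passage_weight_right_derivative :
  right_derivable (fun r => fine (kappa q Z Y theta r)) rho ->
  \int[m]_(p in D) (pas (weight mu rho (rho - mu) nu theta) p)%:E =
  ((fine (kappa q Z Y nu mu))^-1 *
   right_derivative (fun r => fine (kappa q Z Y theta r)) rho)%:E.
Proof.
move=> drho; have mD := measurable_regular_levels Y.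
(* With this choice [mu + lam = rho + 1/(n+1)], so formula (i) becomes a right difference quotient
   of step [1/(n+1)]. *)
pose W n := weight mu rho (rho - mu + n.+1%:R^-1) nu theta.
have hn n : (0 < n.+1%:R^-1 :> R)%R by rewrite invr_gt0.
have k0 : (0 < fine (kappa q Z Y nu mu))%R.
  by apply: fine_gt0; rewrite kappa0; exact: kappa_neq_pinfty.
have intW n : \int[m]_(p in D) (pas (W n) p)%:E =
    ((fine (kappa q Z Y nu mu))^-1 *
     right_quotient (fun r => fine (kappa q Z Y theta r)) rho n.+1%:R^-1)%:E.
  have E1 : (mu + (rho - mu + n.+1%:R^-1) = rho + n.+1%:R^-1)%R by ring.
  rewrite (integral_passage_weight ZY e_exponential e_independent); last 4 first.
  - by rewrite E1 -subr_eq0 addrC addKr gt_eqF.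
  - rewrite E1; apply: lt_le_trans kappa2 _.
    by apply: (le_kappa _ ZY) => //; rewrite lerDl ltW.
  - exact: kappa2.
  - exact: kappa0.
  rewrite !addr0 E1 /right_quotient; congr (_%:E).
  have -> : (rho + n.+1%:R^-1 - rho = n.+1%:R^-1)%R by rewrite addrC addKr.
  by rewrite invfM mulrA mulrC.
have cvgW : \int[m]_(p in D) (pas (W n) p)%:E @[n --> \oo] -->
    ((fine (kappa q Z Y nu mu))^-1 *
     right_derivative (fun r => fine (kappa q Z Y theta r)) rho)%:E.
  under eq_fun do rewrite intW.
  apply: cvg_EFin; first exact: nearW.
  apply: cvgM; first exact: cvg_cst.
  by have /cvg_at_rightP := drho; apply; split => //; exact: cvg_inv_succn.
have Wc u n : seq_continuous4 (W n u) by exact: seq_continuous4_weight.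
have W0 n u a b c f : (0 <= W n u a b c f)%R by exact: weight_ge0.
have mW n : measurable_weight (W n) by exact: measurable_weight_expR.
have lim_pas p : (pas (W n) p)%:E @[n --> \oo] -->
    (pas (weight mu rho (rho - mu) nu theta) p)%:E.
  apply: cvg_EFin; first exact: nearW.
  rewrite /passage /comp/=; case: ifP => _; last exact: cvg_cst.
  apply: continuous_cvg; first exact: continuous_expR.
  apply: cvgB; last exact: cvg_cst.
  apply: cvgB; last exact: cvg_cst.
  apply: cvgB; first exact: cvg_cst.
  apply: cvgM; last exact: cvg_cst.
  rewrite -[X in _ --> X]addr0.
  by apply: (@cvgD R R^o); [exact: cvg_cst|exact: cvg_inv_succn].
have := @cvg_monotone_convergence _ _ _ m D mD (fun n p => (pas (W n) p)%:E).
move=> /(_ (fun n => measurable_passage ZY e_exponential (mW n) (W0 n) (Wc^~ n))).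
move=> /(_ (fun n p _ => passage_ge0 Z Y e (W0 n) p)) mct.
(* As [n] grows, [lam] decreases while its factor [u - y_{t-}] is nonnegative, so the weights
   increase. *)
have nd p : D p -> {homo (fun n => (pas (W n) p)%:E) : k n / (k <= n)%N >-> k <= n}.
  move=> [u0 _] k n kn; rewrite lee_fin /passage; case: ifP => // fe.
  rewrite /W /weight ler_expR lerB// lerB// lerD2l lerN2.
  apply: ler_wpM2r; last by rewrite lerD2l lef_pV2 ?posrE// ler_nat.
  rewrite subr_ge0; apply: left_lim_first_passage_le => //.
  - by have [] := subordinator_cadlag ZY p.2.
  - by have [] := subordinator_start ZY p.2.
  - by apply: lt_le_trans fe _; exact: leey.
have {mct}mct := mct nd.
rewrite -(cvg_lim _ cvgW)// (cvg_lim _ mct)//.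
by apply: eq_integral => p _; apply/esym/cvg_lim.
Qed.

End limit_case.

(** * The two formulas for the iterated integrals *)

Theorem theorem4p3 (d : measure_display) (T : measurableType d) (R : realType)
  (P : probability T R) (Z Y : R -> {RV P >-> R}) (q : R) (e : T -> \bar R)
  (mu rho lambda nu theta : R)
  (ZY_subordinator : bivariate_subordinator Z Y)
  (q_ge0 : 0 <= q)
  (e_exponential : exponential_time P q e)
  (e_independent : independent_of_process e Z Y)
  (kappa1_fin : kappa q Z Y theta (mu + lambda) \is a fin_num)
  (kappa2_fin : kappa q Z Y theta rho \is a fin_num)
  (kappa_gt0 : (0 < kappa q Z Y nu mu)%E) :
  (lambda <> rho - mu ->
    (\int[lebesgue_measure]_(u in `[0%R, +oo[)
       ((expR (- mu * u))%:E *
        expectation_on P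
          (fun w => let z := path_of Z w in let y := path_of Y w in
             let t := fine (first_passage y u) in
             expR (- rho * (y t - u) - lambda * (u - left_lim y t)
                   - nu * left_lim z t - theta * jump z t))
          [set w | first_passage (path_of Y w) u < e w]))%E =
    ((fine (kappa q Z Y theta (mu + lambda)) - fine (kappa q Z Y theta rho)) /
     ((mu + lambda - rho) * fine (kappa q Z Y nu mu)))%:E) /\
  (lambda = rho - mu ->
    right_derivable (fun r => fine (kappa q Z Y theta r)) rho ->
    (\int[lebesgue_measure]_(u in `[0%R, +oo[)
        expectation_on P
          (fun w => let z := path_of Z w in let y := path_of Y w in
             let t := fine (first_passage y u) in
             expR (- rho * jump y t - mu * left_lim y t
                   - nu * left_lim z t - theta * jump z t))
          [set w | first_passage (path_of Y w) u < e w])%E =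
    ((fine (kappa q Z Y nu mu))^-1 *
     right_derivative (fun r => fine (kappa q Z Y theta r)) rho)%:E).

Proof.
have finNy a b : kappa q Z Y a b \is a fin_num -> (-oo < kappa q Z Y a b)%E.
  by rewrite fin_numElt => /andP[].
have kappa1 := finNy _ _ kappa1_fin; have kappa2 := finNy _ _ kappa2_fin.
split=> [lam_neq|lam_eq drho].
  (* The expectation in (i) lacks [exp (- mu u)], so the weight is first taken with parameter 0 in
     place of [mu]; the outer factor is absorbed on the product space. *)
  transitivity (\int[(@lebesgue_measure R \x P)%E]_(p in regular_levels Y)
      (expR (- mu * p.1) * passage (weight 0 rho lambda nu theta)
        (path_of Z p.2) (path_of Y p.2) (e p.2) p.1)%:E)%E.
    rewrite -(iterated_integral_passage ZY_subordinator e_exponential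
      (@measurable_weight_expR R 0 rho lambda nu theta)
      (@weight_ge0 R 0 rho lambda nu theta)
      (@seq_continuous4_weight R 0 rho lambda nu theta)
      (c := fun u => expR (- mu * u))).
    - apply: eq_integral => u _; congr (_ * expectation_on P _ _)%E.
      by apply/funext => w; rewrite /weight /jump; congr expR; ring.
    - by apply: measurableT_comp => //; exact: mulrl_measurable.
    - by move=> u; exact: expR_ge0.
  transitivity (\int[(@lebesgue_measure R \x P)%E]_(p in regular_levels Y)
      (passage (weight mu rho lambda nu theta)
        (path_of Z p.2) (path_of Y p.2) (e p.2) p.1)%:E)%E.
    apply: eq_integral => p _; congr (_%:E); rewrite /passage.
    case: ifP => _; last by rewrite mulr0.
    by rewrite /weight -expRD; congr expR; ring.
  rewrite (integral_passage_weight ZY_subordinator e_exponential e_independent)//.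
    by rewrite !addr0.
  by apply/eqP => E; apply: lam_neq; rewrite -E addrC addKr.
rewrite -(integral_passage_weight_right_derivative ZY_subordinator e_exponential
  e_independent)//.
(* In (ii) nothing stands outside the expectation, so the outer factor is the constant 1. *)
transitivity (\int[(@lebesgue_measure R \x P)%E]_(p in regular_levels Y)
    (1 * passage (weight mu rho (rho - mu) nu theta)
      (path_of Z p.2) (path_of Y p.2) (e p.2) p.1)%:E)%E; last first.
  by apply: eq_integral => p _; rewrite mul1r.
rewrite -(iterated_integral_passage ZY_subordinator e_exponential
  (@measurable_weight_expR R mu rho (rho - mu) nu theta)
  (@weight_ge0 R mu rho (rho - mu) nu theta)
  (@seq_continuous4_weight R mu rho (rho - mu) nu theta) (c := cst 1))//.
apply: eq_integral => u _; rewrite mul1e; congr (expectation_on P _ _).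
by apply/funext => w; rewrite /weight /jump; congr expR; ring.
Qed.
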